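(* Let $\mathcal M$ be a regular triangulation of $\Omega$ into simplices (no hanging nodes), let $W\in C^1(\mathbb R^n)$ be convex, $\psi(x,a)=-f(x)a$ with $f\in P_k(\mathcal M)$, and $\psi_h(x,a)=-(\Pi_{\mathcal M}^kf)(x)\,a=-f(x)a$. Let $u\in\arg\min E(V)$ and $\sigma\in\arg\max E^*(\Sigma)$. Let $u_h\in\arg\min E_h(V_h)$, set $$\sigma_{\mathcal M}=\mathrm DW(\nabla_hu_h),\qquad\sigma_{\mathcal F}|_S=\{\Pi_{\mathcal M}^{k-1}\sigma_{\mathcal M}\}_S\cdot\nu_S-h_S^{-s}|[u_h]_S|^{r-2}[u_h]_S\ \text{ for }S\in\mathcal F\setminus\mathcal F_N,$$ and let $\sigma_{\rm RT}\in{\rm RT}_k(\mathcal M)\cap\Sigma$ be the unique Raviart–Thomas function with $\Pi_{\mathcal M}^{k-1}\sigma_{\rm RT}=\Pi_{\mathcal M}^{k-1}\sigma_{\mathcal M}$ and $\Pi_S^k(\sigma_{\rm RT}\cdot\nu_S)=\Pi_S^k\sigma_{\mathcal F}$ for all $S\in\mathcal F\setminus\mathcal F_N$. Then every conforming post-processing $v_C\in V$ satisfies $$E(v_C)-E(u)\le E(v_C)-E^*(\sigma_{\rm RT})=:\eta.$$ If $W$ satisfies further structural properties, e.g., if $p\ge2$ and $$\delta(\alpha,\beta):=\frac{\|\mathrm DW(\alpha)-\mathrm DW(\beta)\|_{L^{p'}(\Omega)}^2}{\big(1+\|\alpha\|_{L^p(\Omega)}^p+\|\beta\|_{L^p(\Omega)}^p\big)^{(2-p')/p'}}\lesssim\int_\Omega\big(W(\beta)-W(\alpha)-\mathrm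 DW(\alpha)\cdot(\beta-\alpha)\big)\,dx$$ holds for all $\alpha,\beta\in L^p(\Omega)^n$, then $$\delta(\nabla u,\nabla v_C)\lesssim\int_\Omega\big(W(\nabla v_C)-W(\nabla u)-\sigma\cdot\nabla(v_C-u)\big)\,dx=E(v_C)-E(u)\le E(v_C)-E^*(\sigma_{\rm RT})=\eta.$$ (If $f$ is not piecewise polynomial, then an additional data oscillation term arises in this bound, which can be computed explicitly.)
   Context: $A\lesssim B$ means $A\le CB$ with a generic constant $C$ independent of the mesh-size. $\Omega\subset\mathbb R^n$ is an open bounded polyhedral Lipschitz domain, $\Gamma_D\subset\partial\Omega$ is compact with positive surface measure, $\Gamma_N=\partial\Omega\setminus\Gamma_D$, $1<p<\infty$, $p'=p/(p-1)$. $V=W^{1,p}_D(\Omega)$ is the space of $v\in W^{1,p}(\Omega)$ with zero trace on $\Gamma_D$; $\Sigma=W^{p'}_N({\rm div},\Omega)$ is the space of $\tau\in L^{p'}(\Omega)^n$ with ${\rm div}\,\tau\in L^{p'}(\Omega)$ and vanishing normal trace on $\Gamma_N$. $E(v)=\int_\Omega(W(\nabla v)-fv)\,dx$ for $v\in V$; for $\tau\in\Sigma$, $E^*(\tau)=-\int_\Omega W^*(\tau)\,dx$ if ${\rm div}\,\tau=-f$ and $E^*(\tau)=-\infty$ otherwise, where $W^*$ is the convex conjugate of $W$. Standing assumptions: (A1) $-\infty<\inf E(V)\le E(v_0)<\infty$ for some $v_0\in V$ at which $E$ is continuous; (A2) $E(v)\to\infty$ as $\|\nabla v\|_{L^p(\Omega)}\to\infty$,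 $v\in V$. These guarantee that $u$ and $\sigma$ exist with $E(u)=\min E(V)=\max E^*(\Sigma)=E^*(\sigma)$; here $\sigma=\mathrm DW(\nabla u)$. $\mathcal F$ is the set of faces of $\mathcal M$; $\mathcal F_D$ is the set of faces contained in $\Gamma_D$ and $\mathcal F_N$ the set of the remaining boundary faces. $h_S$ is the diameter of $S\in\mathcal F$. Each interior face $S$ has a fixed unit normal $\nu_S$, and $K_+$ (resp. $K_-$) is the adjacent simplex whose outer normal on $S$ is $\nu_S$ (resp. $-\nu_S$); for boundary faces $\nu_S$ is the outer normal of $\Omega$ and $K_+$ the adjacent simplex. $[v]_S=v|_{K_+}-v|_{K_-}$, $\{v\}_S=(v|_{K_+}+v|_{K_-})/2$ on interior faces and $[v]_S=\{v\}_S=v|_{K_+}$ on boundary faces. $P_k(\mathcal M)$ is the space of piecewise polynomials of degree at most $k$; $\Pi_{\mathcal M}^k$, $\Pi_S^k$ are the $L^2$ projections onto $P_k(\mathcal M)$, $P_k(S)$; ${\rm div}_{\rm pw}$ is the piecewise divergence. ${\rm RT}_k(\mathcal M)$ is the space of fields whose restriction to each simplex $K$ has the form $q+x\,\tilde q$ with $q\in P_k(K)^n$, $\tilde q\in P_k(K)$. Fix $k\ge1$, $1<r<\infty$, $s\in\mathbb R$, $V_h=P_k(\mathcal M)$. The discrete gradient $\nabla_hv_h\in P_{k-1}(\mathcal M)^n$ of $v_h\in V_h$ is defined by $\int_\Omega\nabla_hv_h\cdot\Phi\,dx=-\int_\Omega v_h\,{\rm div}_{\rm pw}\Phi\,dx+\sum_{S\in\mathcal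 F\setminus\mathcal F_D}\int_S\{v_h\}_S[\Phi]_S\cdot\nu_S\,ds$ for all $\Phi\in P_{k-1}(\mathcal M)^n$. The discrete energy is $E_h(v_h)=\int_\Omega(W(\nabla_hv_h)+\psi_h(\cdot,v_h))\,dx+\frac1r\sum_{S\in\mathcal F\setminus\mathcal F_N}h_S^{-s}\|[v_h]_S\|_{L^r(S)}^r$, assumed to attain its minimum on $V_h$. *)

(* Defs.v *)
From HB Require Import structures.
From mathcomp Require Import all_boot all_order all_algebra.
From mathcomp Require Import all_classical all_reals all_analysis.
From mathcomp Require Import measurable_realfun.
Import Order.TTheory GRing.Theory Num.Theory.
Import numFieldNormedType.Exports.

Set Implicit Arguments.
Unset Strict Implicit.
Unset Printing Implicit Defensive.

Local Open Scope classical_set_scope.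
Local Open Scope ring_scope.

(* The coordinate (= Borel) sigma-algebra, as the library does for tuples. *)
Definition rV_display : measure_display.
Proof. exact. Qed.

Section rV_measurable.
Context {R : realType} (n : nat).

Let coord : 'I_n -> 'rV[R]_n -> R := fun i x => x ord0 i.

Let rV_set0 : g_sigma_preimage coord set0.
Proof. exact: sigma_algebra0. Qed.

Let rV_setC A : g_sigma_preimage coord A -> g_sigma_preimage coord (~` A).
Proof. exact: sigma_algebraC. Qed.

Let rV_bigcup (F : _^nat) : (forall i, g_sigma_preimage coord (F i)) ->
  g_sigma_preimage coord (\bigcup_i (F i)).
Proof. exact: sigma_algebra_bigcup. Qed.

HB.instance Definition _ := @isMeasurable.Build rV_display
  'rV[R]_n (g_sigma_preimage coord) rV_set0 rV_setC rV_bigcup.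

End rV_measurable.

Lemma measurable_coord (R : realType) n (i : 'I_n) :
  measurable_fun [set: 'rV[R]_n] (fun x : 'rV[R]_n => x ord0 i).
Proof.
move=> _ Y mY; rewrite setTI; apply: sub_sigma_algebra => /=.
rewrite -bigcup_seq/=; exists i => /=; first by rewrite mem_index_enum.
by exists Y => //; rewrite setTI.
Qed.

Lemma measurable_fun_rV (R : realType) d (T : measurableType d) n
    (f : T -> 'rV[R]_n) :
  (forall i, measurable_fun [set: T] (fun t => f t ord0 i)) ->
  measurable_fun [set: T] f.
Proof.
move=> mf _ A mA; rewrite setTI.
have : (g_sigma_preimage (fun (i : 'I_n) (t : T) => f t ord0 i)) `<=` measurable.
  apply: smallest_sub; first exact: sigma_algebra_measurable.
  rewrite -bigcup_seq; apply: bigcup_sub => i _ B [C mC <-]; exact: mf.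
apply; rewrite (g_sigma_preimage_comp (fun (i : 'I_n) (x : 'rV[R]_n) => x ord0 i) f).
by exists A => //; rewrite setTI.
Qed.

(* The point of R^(n+1) with first coordinate [z.1] and remaining ones [z.2]. *)
Definition rvcons (R : realType) n (z : R * 'rV[R]_n) : 'rV[R]_n.+1 :=
  \row_i (if unlift ord0 i is Some j then z.2 ord0 j else z.1).

Lemma measurable_rvcons (R : realType) n :
  measurable_fun [set: R * 'rV[R]_n] (@rvcons R n).
Proof.
apply: measurable_fun_rV => i; rewrite /rvcons.
under [X in measurable_fun _ X]eq_fun do rewrite mxE.
case: (unlift ord0 i) => [j|]; last exact: measurable_fst.
exact: (measurableT_comp (@measurable_coord R n j) measurable_snd).
Qed.

Definition rvuncons (R : realType) n (x : 'rV[R]_n.+1) : R * 'rV[R]_n :=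
  (x ord0 ord0, \row_j x ord0 (lift ord0 j)).

Lemma rvconsK (R : realType) n : cancel (@rvcons R n) (@rvuncons R n).
Proof.
case=> a v; rewrite /rvuncons /rvcons; congr pair.
  by rewrite mxE unlift_none.
by apply/rowP => j; rewrite !mxE liftK.
Qed.

Lemma measurable_rvuncons (R : realType) n :
  measurable_fun [set: 'rV[R]_n.+1] (@rvuncons R n).
Proof.
apply/measurable_fun_pairP; split => /=; first exact: measurable_coord.
apply: measurable_fun_rV => i.
under [X in measurable_fun _ X]eq_fun do rewrite mxE.
exact: measurable_coord.
Qed.

Section image_measure.
Local Open Scope ereal_scope.
Context d d' (T : measurableType d) (T' : measurableType d') (R : realType).
Variables (m : {measure set T -> \bar R}) (f : T -> T').
Variable mf : measurable_fun [set: T] f.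

(* [pushforward m f], carrying the measurability proof so that the measure
   structure is inferable. *)
Definition image_measure of measurable_fun [set: T] f := pushforward m f.

Let image_measure0 : image_measure mf set0 = 0.
Proof. by rewrite /image_measure /pushforward preimage_set0 measure0. Qed.

Let image_measure_ge0 A : 0 <= image_measure mf A.
Proof. exact: measure_ge0. Qed.

Let image_measure_sigma_additive : semi_sigma_additive (image_measure mf).
Proof.
move=> F mF tF mUF; rewrite /image_measure /pushforward preimage_bigcup.
apply: measure_semi_sigma_additive.
- by move=> n; rewrite -[X in measurable X]setTI; exact: mf.
- apply/trivIsetP => /= i j _ _ ij; rewrite -preimage_setI.
  by move/trivIsetP : tF => /(_ _ _ _ _ ij) ->//; rewrite preimage_set0.
- by rewrite -preimage_bigcup -[X in measurable X]setTI; exact: mf.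
Qed.

HB.instance Definition _ := isMeasure.Build _ _ _ (image_measure mf)
  image_measure0 image_measure_ge0 image_measure_sigma_additive.

End image_measure.

Section lebesgue_step.
Context {R : realType} (n : nat).
Variable m : {sigma_finite_measure set 'rV[R]_n -> \bar R}.

Definition leb_step : set 'rV[R]_n.+1 -> \bar R :=
  image_measure ((@lebesgue_measure R) \x m)%E (@measurable_rvcons R n).

HB.instance Definition _ := Measure.on leb_step.

Let leb_step_sigma_finite : sigma_finite setT leb_step.
Proof.
have /sigma_finiteP[F [TF ndF Foo]] := sigma_finiteT (@lebesgue_measure R).
have /sigma_finiteP[G [TG ndG Goo]] := sigma_finiteT m.
exists (fun k => @rvuncons R n @^-1` (F k `*` G k)).
  rewrite predeqE => x; split=> // _.
  have [i _ Fi] : (\bigcup_k F k) (rvuncons x).1 by rewrite -TF.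
  have [j _ Gj] : (\bigcup_k G k) (rvuncons x).2 by rewrite -TG.
  exists (maxn i j) => //; split.
    by move: Fi; exact/subsetPset/ndF/leq_maxl.
  by move: Gj; exact/subsetPset/ndG/leq_maxr.
move=> k; have [mF Fk] := Foo k; have [mG Gk] := Goo k; split.
  by rewrite -[X in measurable X]setTI; apply: measurable_rvuncons => //;
    exact: measurableX.
rewrite /leb_step /image_measure /pushforward.
have -> : @rvcons R n @^-1` (@rvuncons R n @^-1` (F k `*` G k)) = F k `*` G k.
  by apply/funext => z; exact: (congr1 (F k `*` G k) (rvconsK z)).
rewrite [X in (X < _)%E](_ : _ = lebesgue_measure (F k) * m (G k))%E; last first.
  exact: (product_measure1E (@lebesgue_measure R) m mF mG).
by rewrite lte_mul_pinfty// ge0_fin_numE.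
Qed.

HB.instance Definition _ := Measure_isSigmaFinite.Build _ _ _ leb_step
  leb_step_sigma_finite.

End lebesgue_step.

Fixpoint leb {R : realType} (n : nat) :
    {sigma_finite_measure set 'rV[R]_n -> \bar R} :=
  match n with
  | 0 => \d_(0 : 'rV[R]_0)
  | n'.+1 => leb_step (leb n')
  end.

Section calculus.
Context {R : realType} {d : nat}.
Implicit Types (x y : 'rV[R]_d) (phi W : 'rV[R]_d -> R).

Definition dotv x y : R := \sum_i x ord0 i * y ord0 i.

(* The library norm on matrices is the sup norm. *)
Definition enorm x : R := Num.sqrt (dotv x x).

Definition partial (i : 'I_d) phi x : R := 'D_(delta_mx ord0 i) phi x.

Definition egrad phi x : 'rV[R]_d := \row_i partial i phi x.

Definition C1 phi : Prop :=
  (forall x, differentiable phi x) /\ continuous (egrad phi).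

Definition smooth phi : Prop := forall (s : seq 'I_d) x,
  differentiable (foldr partial phi s) x.

Definition convex_fun W : Prop := forall x y (t : R), 0 <= t <= 1 ->
  W (t *: x + (1 - t) *: y) <= t * W x + (1 - t) * W y.

Definition convex_conj W y : \bar R :=
  ereal_sup [set (dotv y x - W x)%:E | x in [set: 'rV[R]_d]].

Definition test_fun (Omega : set 'rV[R]_d) phi : Prop :=
  smooth phi /\
  exists K, [/\ compact K, K `<=` Omega & forall x, ~ K x -> phi x = 0].

Definition bd (Omega : set 'rV[R]_d) : set 'rV[R]_d :=
  closure Omega `\` interior Omega.

Definition diam (A : set 'rV[R]_d) : R :=
  sup [set enorm (z.1 - z.2) | z in A `*` A].

End calculus.

Definition lipschitz_domain (R : realType) n (Omega : set 'rV[R]_n.+1) : Prop :=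
  [/\ open Omega, connected Omega, Omega !=set0, bounded_set Omega &
   forall x0, bd Omega x0 ->
     (* orthonormal frame [Q] at [x0]; [Omega] is locally the strict subgraph
        of the Lipschitz function [g] *)
     exists (Q : 'M[R]_n.+1) (a b L : R) (g : 'rV[R]_n -> R),
     [/\ Q *m Q^T = 1%:M, 0 < a, 0 < b,
         (forall y z, `|g y - g z| <= L * enorm (y - z)) &
         forall y t, enorm y < a -> `|t| < b ->
           let x := x0 + rvcons (t, y) *m Q in
           [/\ `|g y| <= b / 2, Omega x <-> t < g y & bd Omega x <-> t = g y]]].

Section lebesgue_spaces.
Context {R : realType} {d : nat}.
Variables (Omega : set 'rV[R]_d) (q : R).

Definition intO (g : 'rV[R]_d -> R) : R := \int[leb d]_(x in Omega) g x.

Definition Lpow (g : 'rV[R]_d -> R) : \bar R :=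
  (\int[leb d]_(x in Omega) (`|g x| `^ q)%:E)%E.

Definition Lpnorm (g : 'rV[R]_d -> R) : \bar R := (Lpow g `^ q^-1)%E.

Definition in_Lp (g : 'rV[R]_d -> R) : Prop :=
  measurable_fun Omega g /\ (Lpow g < +oo)%E.

Definition in_Lpv (G : 'rV[R]_d -> 'rV[R]_d) : Prop :=
  measurable_fun Omega G /\ (Lpow (enorm \o G) < +oo)%E.

Definition W1pnorm (g : 'rV[R]_d -> R) (G : 'rV[R]_d -> 'rV[R]_d) : \bar R :=
  ((Lpow g + Lpow (enorm \o G)) `^ q^-1)%E.

(* An element of W^{1,q}(Omega): a representative with a representative of its
   weak gradient. *)
Record W1p := {
  wfun :> 'rV[R]_d -> R;
  wgrad : 'rV[R]_d -> 'rV[R]_d;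
  wfun_Lp : in_Lp wfun;
  wgrad_Lp : in_Lpv wgrad;
  wgradP : forall phi i, test_fun Omega phi ->
    intO (fun x => wfun x * partial i phi x) =
    - intO (fun x => wgrad x ord0 i * phi x) }.

(* [g] represents the trace of [v]: the boundary values of C^1 functions
   converging to [v] in W^{1,q} converge to [g] in L^q of the boundary, [mu]
   being the surface measure. *)
Definition is_trace (mu : {measure set 'rV[R]_d -> \bar R}) (v : W1p)
    (g : 'rV[R]_d -> R) : Prop :=
  measurable_fun setT g /\
  exists phi : nat -> 'rV[R]_d -> R,
  [/\ forall j, C1 (phi j),
      (fun j => W1pnorm (fun x => phi j x - v x)
                        (fun x => egrad (phi j) x - wgrad v x)) @ \oo --> 0%E &
      (fun j => \int[mu]_x (`|phi j x - g x| `^ q)%:E)%E @ \oo --> 0%E].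

Record W1pD (mu : {measure set 'rV[R]_d -> \bar R}) (GammaD : set 'rV[R]_d) := {
  dfun :> W1p;
  zero_trace : exists2 g, is_trace mu dfun g &
    {ae mu, forall x, GammaD x -> g x = 0} }.

End lebesgue_spaces.

Arguments wgrad {R d Omega q}.

(* W^{q'}_N(div, Omega), q' the exponent conjugate to q; the normal trace of tau
   is the functional v |-> \int (tau . grad v + v div tau), and it vanishes on
   Gamma_N when it is zero on the functions that vanish on Gamma_D. *)
Record WdivN {R : realType} {d : nat} (Omega : set 'rV[R]_d) (q q' : R)
    (mu : {measure set 'rV[R]_d -> \bar R}) (GammaD : set 'rV[R]_d) := {
  tfun :> 'rV[R]_d -> 'rV[R]_d;
  wdiv : 'rV[R]_d -> R;
  tfun_Lp : in_Lpv Omega q' tfun;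
  wdiv_Lp : in_Lp Omega q' wdiv;
  wdivP : forall phi, test_fun Omega phi ->
    intO Omega (fun x => dotv (tfun x) (egrad phi x)) =
    - intO Omega (fun x => wdiv x * phi x);
  zero_normal_trace : forall v : W1pD Omega q mu GammaD,
    intO Omega (fun x => dotv (tfun x) (wgrad v x) + wdiv x * v x) = 0 }.

Section energies.
Context {R : realType} {d : nat}.
Variables (Omega : set 'rV[R]_d) (p p' : R).
Variables (mu : {measure set 'rV[R]_d -> \bar R}) (GammaD : set 'rV[R]_d).
Variables (W f : 'rV[R]_d -> R).

Local Notation V := (W1pD Omega p mu GammaD).
Local Notation Sigma := (WdivN Omega p p' mu GammaD).

Definition energy (v : V) : \bar R :=
  (\int[leb d]_(x in Omega) (W (wgrad v x) - f x * v x)%:E)%E.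

Definition dual_energy (tau : Sigma) : \bar R :=
  if `[< {ae leb d, forall x, Omega x -> wdiv tau x = - f x} >]
  then (- \int[leb d]_(x in Omega) convex_conj W (tau x))%E else -oo%E.

Definition assumption_A1 : Prop :=
  (-oo < ereal_inf (range energy))%E /\
  exists v0 : V, (energy v0 < +oo)%E /\
    forall e : R, 0 < e -> exists2 t : R, 0 < t & forall v : V,
      (W1pnorm Omega p (fun x => (v x - v0 x)%R)
                 (fun x => (wgrad v x - wgrad v0 x)%R) < t%:E)%E ->
      (`|energy v - energy v0| < e%:E)%E.

Definition assumption_A2 : Prop :=
  forall A : R, exists B : R, forall v : V,
    (B%:E <= Lpnorm Omega p (enorm \o wgrad v))%E -> (A%:E <= energy v)%E.

Definition delta (al be : 'rV[R]_d -> 'rV[R]_d) : \bar R :=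
  (Lpnorm Omega p' (fun x => enorm (egrad W (al x) - egrad W (be x))%R) ^+ 2 /
   (1 + Lpow Omega p (enorm \o al) + Lpow Omega p (enorm \o be))
     `^ ((2 - p') / p')%R)%E.

Definition bregman (al be s : 'rV[R]_d -> 'rV[R]_d) : \bar R :=
  (\int[leb d]_(x in Omega)
     (W (be x) - W (al x) - dotv (s x) (be x - al x))%:E)%E.

End energies.

(* Simplices and faces are represented by their sets of vertices. *)
Record mesh (R : realType) (d : nat) := {
  nvert : nat;
  vert : 'I_nvert -> 'rV[R]_d;
  cells : {set {set 'I_nvert}} }.

Arguments nvert {R d}.
Arguments vert {R d}.
Arguments cells {R d}.

Section mesh_geometry.
Context {R : realType} {n : nat}.
Variable M : mesh R n.+1.
Local Notation simplex := {set 'I_(nvert M)}.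
Implicit Types (K S : simplex).

Definition hull S : set 'rV[R]_n.+1 :=
  [set x | exists c : 'I_(nvert M) -> R,
    [/\ forall i, 0 <= c i, forall i, i \notin S -> c i = 0,
        \sum_i c i = 1 & x = \sum_i c i *: vert M i]].

Definition affinely_independent S : Prop :=
  forall c : 'I_(nvert M) -> R, (forall i, i \notin S -> c i = 0) ->
    \sum_i c i = 0 -> \sum_i c i *: vert M i = 0 -> forall i, c i = 0.

Definition triangulation (Omega : set 'rV[R]_n.+1) : Prop :=
  [/\ injective (vert M),
      forall K, K \in cells M -> #|K| = n.+2 /\ affinely_independent K,
      forall K K', K \in cells M -> K' \in cells M ->
        hull K `&` hull K' = hull (K :&: K')%SET &
      closure Omega = [set x | exists2 K, K \in cells M & hull K x]].

Definition is_face S : bool :=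
  (#|S| == n.+1) && [exists K in cells M, S \subset K].

(* The affine map from the reference simplex {y >= 0, sum y <= 1} of R^n onto
   the face [S], and its volume element. *)
Definition face_vertex S (j : nat) : 'rV[R]_n.+1 :=
  nth 0 [seq vert M i | i <- enum S] j.

Definition face_edges S : 'M[R]_(n, n.+1) :=
  \matrix_(j < n) (face_vertex S j.+1 - face_vertex S 0).

Definition face_map S (y : 'rV[R]_n) : 'rV[R]_n.+1 :=
  face_vertex S 0 + y *m face_edges S.

Definition face_jacobian S : {nonneg R} :=
  NngNum (sqrtr_ge0 (\det (face_edges S *m (face_edges S)^T))).

Lemma measurable_face_map S : measurable_fun setT (face_map S).
Proof.
apply: measurable_fun_rV => i; rewrite /face_map.
under [X in measurable_fun _ X]eq_fun do rewrite !mxE.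
apply: measurable_funD => //; apply: measurable_sum => j.
by apply: measurable_funM => //; exact: measurable_coord.
Qed.

Definition ref_simplex : set 'rV[R]_n :=
  [set y | (forall i, 0 <= y ord0 i) /\ \sum_i y ord0 i <= 1].

Lemma measurable_ref_simplex : measurable ref_simplex.
Proof.
have mle (g h : 'rV[R]_n -> R) : measurable_fun setT g ->
    measurable_fun setT h -> measurable [set y | g y <= h y].
  move=> mg mh; have := measurable_fun_ler mg mh.
  by move=> /(_ measurableT [set true] I); rewrite setTI.
rewrite (_ : ref_simplex = \bigcap_(i in [set: 'I_n]) [set y | 0 <= y ord0 i]
    `&` [set y | \sum_i y ord0 i <= 1]); last first.
  apply/seteqP; split=> y [y0 y1]; split=> //.
    by move=> i _; exact: y0.
  by move=> i; exact: (y0 i I).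
apply: measurableI.
  apply: fin_bigcap_measurable => [|i _]; first exact: finite_finset.
  by apply: mle => //; exact: measurable_coord.
apply: mle => //; apply: measurable_sum => i; exact: measurable_coord.
Qed.

Definition face_measure S : set 'rV[R]_n.+1 -> \bar R :=
  mscale (face_jacobian S)
    (image_measure (mrestr (leb n) measurable_ref_simplex)
                   (measurable_face_map S)).

HB.instance Definition _ S := Measure.on (face_measure S).

(* Sum of the surface measures of the faces of [M] lying in the boundary; it does
   not depend on the triangulation [M] of [Omega]. *)
Definition surface_measure (Omega : set 'rV[R]_n.+1) :
    set 'rV[R]_n.+1 -> \bar R :=
  let s := [seq S <- enum {: simplex} |
             is_face S && `[< hull S `<=` bd Omega >]] in
  msum (fun j => face_measure (nth finset.set0 s j)) (size s).

HB.instance Definition _ Omega := Measure.on (surface_measure Omega).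

End mesh_geometry.

Definition is_poly (R : realType) d (k : nat) (q : 'rV[R]_d -> R) : Prop :=
  exists c : {ffun 'I_d -> 'I_k.+1} -> R, forall x,
    q x = \sum_(m : {ffun 'I_d -> 'I_k.+1} | (\sum_i m i <= k)%N)
            c m * \prod_i x ord0 i ^+ m i.

Section discrete.
Context {R : realType} {n : nat}.
Variables (M : mesh R n.+1) (Omega GammaD : set 'rV[R]_n.+1).
Local Notation simplex := {set 'I_(nvert M)}.
Local Notation E := 'rV[R]_n.+1.

(* A piecewise function is a family indexed by the simplices; only the values on
   the (closed) cells matter.  Its restriction to a cell thus has a well-defined
   value on the faces of that cell. *)
Local Notation broken T := (simplex -> E -> T).
Implicit Types (K S : simplex).

(* The associated function on R^(n+1), determined outside the skeleton. *)
Definition pw_glue (T : zmodType) (v : broken T) (x : E) : T :=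
  if [pick K | (K \in cells M) && `[< hull K x >]] is Some K then v K x else 0.

Definition intM (g : broken R) : R :=
  \sum_(K in cells M) \int[leb n.+1]_(x in hull K) g K x.

Definition int_face S (g : E -> R) : R := \int[face_measure S]_x g x.

Definition Pk (k : nat) (v : broken R) : Prop :=
  forall K, K \in cells M -> is_poly k (v K).

Definition Pkv (k : nat) (v : broken E) : Prop :=
  forall K i, K \in cells M -> is_poly k (fun x => v K x ord0 i).

Definition RT (k : nat) (v : broken E) : Prop :=
  exists (q : broken E) (qt : broken R),
    [/\ Pkv k q, Pk k qt &
        forall K x, K \in cells M -> v K x = q K x + qt K x *: x].

Definition projM (k : nat) (g : broken R) : broken R :=
  xget (fun _ _ => 0) [set P : broken R | Pk k P /\
    forall phi, Pk k phi -> intM (fun K x => (g K x - P K x) * phi K x) = 0].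

Definition projMv (k : nat) (g : broken E) : broken E :=
  xget (fun _ _ => 0) [set P : broken E | Pkv k P /\
    forall Phi, Pkv k Phi -> intM (fun K x => dotv (g K x - P K x) (Phi K x)) = 0].

(* P_k(S) is the set of restrictions to [hull S] of polynomials on R^(n+1). *)
Definition projS (k : nat) S (g : E -> R) : E -> R :=
  xget (fun _ => 0) [set P : E -> R | is_poly k P /\
    forall phi, is_poly k phi -> int_face S (fun x => (g x - P x) * phi x) = 0].

Definition boundary_face S : bool := is_face S && `[< hull S `<=` bd Omega >].
Definition dirichlet_face S : bool := boundary_face S && `[< hull S `<=` GammaD >].
Definition neumann_face S : bool := boundary_face S && ~~ dirichlet_face S.

Definition hS S : R := diam (hull S).

(* [nu] is the outer unit normal of the cell [K] on its face [S]. *)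
Definition outer_normal K S (nu : E) : Prop :=
  [/\ enorm nu = 1,
      forall i j, i \in S -> j \in S -> dotv nu (vert M i - vert M j) = 0 &
      forall i j, i \in K -> i \notin S -> j \in S ->
        dotv nu (vert M i - vert M j) < 0].

(* On a boundary face there is a single adjacent cell, so [nu S] is the outer
   normal of [Omega]. *)
Definition normals (nu : simplex -> E) : Prop :=
  forall S, is_face S ->
    exists K, [/\ K \in cells M, S \subset K & outer_normal K S (nu S)].

Variable nu : simplex -> E.

Definition Kplus S : option simplex :=
  [pick K | [&& K \in cells M, S \subset K & `[< outer_normal K S (nu S) >]]].

Definition Kminus S : option simplex :=
  [pick K | [&& K \in cells M, S \subset K & `[< outer_normal K S (- nu S) >]]].

Definition side (T : zmodType) (o : option simplex) (v : broken T) (x : E) : T :=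
  if o is Some K then v K x else 0.

(* [Kminus S] is [None] on boundary faces. *)
Definition jump (T : zmodType) (v : broken T) S (x : E) : T :=
  side (Kplus S) v x - side (Kminus S) v x.

Definition avg (T : lmodType R) (v : broken T) S (x : E) : T :=
  if Kminus S is Some K then 2^-1 *: (side (Kplus S) v x + v K x)
  else side (Kplus S) v x.

Definition divpw (Phi : broken E) : broken R :=
  fun K x => \sum_i partial i (fun y => Phi K y ord0 i) x.

Definition dgrad (k : nat) (v : broken R) : broken E :=
  xget (fun _ _ => 0) [set G : broken E | Pkv k.-1 G /\
    forall Phi, Pkv k.-1 Phi ->
      intM (fun K x => dotv (G K x) (Phi K x)) =
      - intM (fun K x => v K x * divpw Phi K x) +
      \sum_(S | is_face S && ~~ dirichlet_face S)
        int_face S (fun x => avg (v : broken R^o) S x * dotv (jump Phi S x) (nu S))].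

Definition discrete_energy (W : E -> R) (fh : broken R) (k : nat) (r s : R)
    (v : broken R) : R :=
  intM (fun K x => W (dgrad k v K x) - fh K x * v K x) +
  r^-1 * \sum_(S | is_face S && ~~ neumann_face S)
    hS S `^ (- s) * int_face S (fun x => `|jump v S x| `^ r).

Definition sigmaM (W : E -> R) (k : nat) (uh : broken R) : broken E :=
  fun K x => egrad W (dgrad k uh K x).

Definition sigmaF (W : E -> R) (k : nat) (r s : R) (uh : broken R) S (x : E) : R :=
  dotv (avg (projMv k.-1 (sigmaM W k uh)) S x) (nu S) -
  hS S `^ (- s) * `|jump uh S x| `^ (r - 2) * jump uh S x.

(* [tau] is the function on Omega and [rt] its piecewise form; by normal
   continuity of [tau] in W_N(div) the normal component on a face may be taken
   from the cell [Kplus S]. *)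
Definition RT_reconstruction (W : E -> R) (k : nat) (r s : R) (uh : broken R)
    (tau : E -> E) : Prop :=
  exists rt : broken E,
  [/\ RT k rt,
      {ae leb n.+1, forall x, Omega x -> tau x = pw_glue rt x},
      forall K x, K \in cells M -> hull K x ->
        projMv k.-1 rt K x = projMv k.-1 (sigmaM W k uh) K x &
      forall S x, is_face S -> ~~ neumann_face S -> hull S x ->
        projS k S (fun y => dotv (side (Kplus S) rt y) (nu S)) x =
        projS k S (sigmaF W k r s uh S) x].

End discrete.

(* Main.v *)
Require Import Defs.
From HB Require Import structures.
From mathcomp Require Import all_boot all_order all_algebra.
From mathcomp Require Import all_classical all_reals all_analysis.
From mathcomp Require Import measurable_realfun ring lra.
Import Order.TTheory GRing.Theory Num.Theory.
Import numFieldNormedType.Exports.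

Set Implicit Arguments.
Unset Strict Implicit.
Unset Printing Implicit Defensive.

Local Open Scope classical_set_scope.
Local Open Scope ring_scope.

(** Weak duality E*(tau) <= E(u) is the pointwise Fenchel inequality integrated
    over Omega, the coupling terms being handled by the normal-trace identity of
    tau; this gives the first bound.

    For the second one, [delta <= C0 * bregman] applied to 0 and to truncations
    of a field beta, with Young's inequality and absorption (p' <= 2), shows that
    DW maps L^p to L^{p'}.  Hence all energies are finite, the Euler-Lagrange
    equation of u follows by dominated convergence, and tau := DW(grad u) lies
    in Sigma with div tau = -f and E*(tau) = E(u); that test functions belong to
    V rests on integration by parts.  Maximality of sigma then forces
    E*(sigma) = E(u), so the Fenchel gap of (grad u, sigma) vanishes a.e., i.e.
    sigma = DW(grad u).  With the normal-trace identity for sigma the Bregman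
    integral is exactly E(vC) - E(u). *)

(** * Borel sets and Lebesgue measure on row vectors *)

(** No growth condition is imposed on [W], so neither finite energies nor differentiation under the
    integral can be taken for granted; the second bound draws both from the structural inequality.
    Estimating the right side of that inequality by Young's inequality brings back the very quantity
    to be bounded, the [q]-th power integral of [DW(0) - DW(beta)], with [q] the conjugate exponent.
    Absorbing it makes sense only if it is finite. For a truncated field it is, [DW] being
    continuous; the resulting bound depends on the [L^p] norm of the field but not on the truncation
    level, so it survives the limit.

    The first bound comes before all this: there the finiteness of [E(u)] is read off (A1), and the
    integrability of [W(grad u)] is deduced from it.

    The measurable sets of row vectors are generated by the coordinates, and the Lebesgue measure is
    built one coordinate at a time. Measurability of continuous maps and integration by parts are
    therefore derived from these constructions. *)

Section rV_borel.
Context {R : realType}.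

Lemma measurable_rV_ball d (a : 'rV[R]_d) (e : R) :
  measurable [set y : 'rV[R]_d | forall i, `|y ord0 i - a ord0 i| < e].
Proof.
rewrite (_ : [set y | _] = \bigcap_(i in [set: 'I_d])
    [set y : 'rV[R]_d | `|y ord0 i - a ord0 i| < e]); last first.
  by apply/seteqP; split => y /= h; [move=> i _; exact: h | move=> i; exact: h].
apply: fin_bigcap_measurable => [|i _]; first exact: finite_finset.
have mg : measurable_fun setT (fun y : 'rV[R]_d => `|y ord0 i - a ord0 i|).
  apply: measurableT_comp => //; apply: measurable_funB => //.
  exact: measurable_coord.
have := measurable_fun_ltr mg (measurable_cst e).
by move=> /(_ measurableT [set true] I); rewrite setTI.
Qed.

Lemma measurable_rV_box d (b : R) :
  measurable [set y : 'rV[R]_d | forall i, `|y ord0 i - 0| < b].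
Proof.
have := measurable_rV_ball (0 : 'rV[R]_d) b.
by under eq_set do under eq_forall do rewrite mxE.
Qed.

(** The coordinate sigma-algebra makes no reference to the topology. Boxes with rational centre and
    radius [1/(k+1)] form a countable base of the sup-norm topology, so an open set is the countable
    union of the boxes it contains. *)
Lemma open_measurable_rV d (A : set 'rV[R]_d) : open A -> measurable A.
Proof.
move=> oA.
pose box (z : 'rV[rat]_d * nat) := [set y : 'rV[R]_d |
  forall i, `|y ord0 i - (map_mx ratr z.1) ord0 i| < z.2.+1%:R^-1].
have -> : A = \bigcup_z (if `[< box z `<=` A >] then box z else set0).
  apply/seteqP; split => [x Ax|x [z _]]; last by case: ifPn => // /asboolP; exact.
  have /nbhs_ballP[e /= e0 xeA] := open_nbhs_nbhs (conj oA Ax).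
  have [k ke] : exists k : nat, k.+1%:R^-1 < e / 2.
    exists (Num.truncn (e / 2)^-1).
    by rewrite invf_plt ?posrE ?divr_gt0// truncnS_gt.
  have /choice[q qP] : forall i : 'I_d, exists q : rat,
      `|x ord0 i - ratr q| < k.+1%:R^-1.
    move=> i; have [q] := @rat_in_itvoo R (x ord0 i - k.+1%:R^-1)
      (x ord0 i + k.+1%:R^-1) (ltac:(by rewrite ltrBlDr -addrA ltrDl addr_gt0)).
    rewrite in_itv/= => /andP[q1 q2]; exists q.
    by rewrite ltr_distlC; apply/andP; split.
  pose z := (\row_i q i, k).
  exists z => //; have xz : box z x by move=> i; rewrite /= !mxE.
  case: asboolP => // -[] y yz; apply: xeA.
  split => // i j; rewrite (ord1 i) -ball_normE /=.
  have := yz j; have := xz j; rewrite /= !mxE => h1 h2.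
  rewrite (le_lt_trans (ler_distD (ratr (q j)) _ _))// [X in _ + X]distrC.
  by rewrite [e]splitr ltrD// (lt_trans _ ke)//.
have c : countable [set: 'rV[rat]_d * nat] by exact: countableP.
apply: countable_bigcupT_measurable => // z.
by case: ifP => // _; exact: measurable_rV_ball.
Qed.

Lemma continuous_measurable_rV d (D : set 'rV[R]_d) (f : 'rV[R]_d -> R) :
  continuous f -> measurable_fun D f.
Proof.
move=> cf; apply: (measurable_funS measurableT) => //.
apply: (measurability _ (RGenOpens.measurableE R)) => _ [_ [a [b ->] <-]].
rewrite setTI; apply: open_measurable_rV.
by apply: open_comp => [x _|]; [exact: cf|exact: interval_open].
Qed.

(** [measurable_fun_rV] concerns maps on the whole space; extension by zero brings a map known only
    on [D] into its scope. *)
Lemma measurable_extend0_rV d (T : measurableType d) n (D : set T)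
    (f : T -> 'rV[R]_n) : measurable D ->
  (forall i, measurable_fun D (fun t => f t ord0 i)) ->
  measurable_fun setT (fun t => if t \in D then f t else 0).
Proof.
move=> mD mf; apply: measurable_fun_rV => i.
rewrite (_ : (fun t => _) = (fun t => f t ord0 i) \_ D).
  exact: (measurable_restrict _ mD measurableT).1 (measurable_funS _ _ (mf i)).
by apply/funext => t; rewrite patchE; case: ifP => //; rewrite mxE.
Qed.

Lemma measurable_fun_rV_dom d (T : measurableType d) n (D : set T)
    (f : T -> 'rV[R]_n) : measurable D ->
  (forall i, measurable_fun D (fun t => f t ord0 i)) -> measurable_fun D f.
Proof.
move=> mD mf _ Y mY; have := measurable_extend0_rV mD mf measurableT mY.
rewrite setTI => mgY.
rewrite (_ : _ `&` _ = D `&` (fun t => if t \in D then f t else 0) @^-1` Y).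
  exact: measurableI.
by apply/seteqP; split => t [Dt]; rewrite /= mem_set.
Qed.

Lemma measurable_fun_coord d (T : measurableType d) n (D : set T)
    (f : T -> 'rV[R]_n) i :
  measurable_fun D f -> measurable_fun D (fun t => f t ord0 i).
Proof. move=> mf; exact: (measurableT_comp (@measurable_coord R n i) mf). Qed.

Lemma continuous_measurable_rVv d n (D : set 'rV[R]_d)
    (f : 'rV[R]_d -> 'rV[R]_n) :
  continuous f -> measurable_fun D f.
Proof.
move=> cf; apply: (measurable_funS measurableT) => //.
apply: measurable_fun_rV => i; apply: continuous_measurable_rV => x.
exact: (continuous_comp (cf x) (@coord_continuous R 1 n ord0 i (f x))).
Qed.

Lemma leb_step_rectangle n (m : {sigma_finite_measure set 'rV[R]_n -> \bar R})
    (A : set R) (B : set 'rV[R]_n) : measurable A -> measurable B ->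
  leb_step m [set x | (A `*` B) (rvuncons x)] = (lebesgue_measure A * m B)%E.
Proof.
move=> mA mB; rewrite /leb_step /image_measure /pushforward.
have -> : @rvcons R n @^-1` [set x | (A `*` B) (rvuncons x)] = A `*` B.
  by apply/funext => z; exact: (congr1 (A `*` B) (rvconsK z)).
exact: (product_measure1E (@lebesgue_measure R) m mA mB).
Qed.

Lemma leb_box_lty d (b : R) :
  (leb d [set x : 'rV[R]_d | forall i, `|x ord0 i - 0| < b]%R < +oo)%E.
Proof.
elim: d => [|d IH].
  rewrite (_ : [set x | _] = setT) ?diracT ?ltry//.
  by apply/seteqP; split => // x _ [].
rewrite (_ : [set x | _] = [set x : 'rV[R]_d.+1 | (`]-b, b[%classic `*`
    [set x : 'rV[R]_d | forall i, `|x ord0 i - 0| < b]) (rvuncons x)]).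
  rewrite [X in (X < _)%E](@leb_step_rectangle _ (leb d))//; last first.
    exact: measurable_rV_box.
  by rewrite lte_mul_pinfty// ?lebesgue_measure_itv//=; case: ifP.
apply/seteqP; split => x /=; rewrite /rvuncons/= => h.
  split => [|i]; last by rewrite mxE; exact: h.
  by have := h ord0; rewrite subr0 ltr_norml in_itv.
case: h => h0 h i; case: (unliftP ord0 i) => [j|] ->.
  by have := h j; rewrite mxE.
by rewrite subr0 ltr_norml; move: h0; rewrite in_itv.
Qed.

Lemma coord_le_norm d (x : 'rV[R]_d) i : `|x ord0 i| <= `|x|.
Proof.
rewrite {2}/Num.norm/= mx_normrE.
by apply/bigmax_geP; right; exists (ord0, i).
Qed.

Lemma bounded_leb_lty d (A : set 'rV[R]_d) : measurable A -> bounded_set A ->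
  (leb d A < +oo)%E.
Proof.
(* Boundedness gives [|x| <= c] only for [c > b], and the box is strict: hence [b + 2], reached
   through [c = b + 1]. *)
move=> mA [b [_ bA]]; apply: le_lt_trans (leb_box_lty d (b + 2)).
have mB := @measurable_rV_box d (b + 2).
apply: le_measure; rewrite ?inE// => x Ax i; rewrite subr0.
apply: (le_lt_trans (coord_le_norm x i)).
by rewrite (le_lt_trans (bA (b + 1) _ x Ax))// ?ltrDl// ltrD2l ltr1n.
Qed.

End rV_borel.

(** * Euclidean inner product and norm *)

Section euclidean.
Context {R : realType} {d : nat}.
Implicit Types x y z : 'rV[R]_d.

Lemma dotvC x y : dotv x y = dotv y x.
Proof. by apply: eq_bigr => i _; rewrite mulrC. Qed.

Lemma dotvDl x y z : dotv (x + y) z = dotv x z + dotv y z.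
Proof. by rewrite -big_split; apply: eq_bigr => i _; rewrite mxE mulrDl. Qed.

Lemma dotvZl (t : R) x y : dotv (t *: x) y = t * dotv x y.
Proof. by rewrite mulr_sumr; apply: eq_bigr => i _; rewrite mxE mulrA. Qed.

Lemma dotvNl x y : dotv (- x) y = - dotv x y.
Proof. by rewrite -scaleN1r dotvZl mulN1r. Qed.

Lemma dotvBl x y z : dotv (x - y) z = dotv x z - dotv y z.
Proof. by rewrite dotvDl dotvNl. Qed.

Lemma dotvDr x y z : dotv x (y + z) = dotv x y + dotv x z.
Proof. by rewrite !(dotvC x) dotvDl. Qed.

Lemma dotvZr (t : R) x y : dotv x (t *: y) = t * dotv x y.
Proof. by rewrite !(dotvC x) dotvZl. Qed.

Lemma dotvBr x y z : dotv x (y - z) = dotv x y - dotv x z.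
Proof. by rewrite !(dotvC x) dotvBl. Qed.

Lemma dotv0l y : dotv 0 y = 0 :> R.
Proof. by rewrite -(scale0r y) dotvZl mul0r. Qed.

Lemma dotv0r y : dotv y 0 = 0 :> R.
Proof. by rewrite dotvC dotv0l. Qed.

Lemma dotv_delta x i : dotv x (delta_mx ord0 i) = x ord0 i.
Proof.
rewrite /dotv (bigD1 i)//= big1 ?addr0 => [|j ji]; rewrite mxE eqxx/=.
  by rewrite eqxx mulr1.
by rewrite (negbTE ji) mulr0.
Qed.

Lemma dotv_ge0 x : 0 <= dotv x x.
Proof. by apply: sumr_ge0 => i _; rewrite -expr2 sqr_ge0. Qed.

Lemma sqr_coord_le x i : x ord0 i ^+ 2 <= dotv x x.
Proof.
rewrite /dotv (bigD1 i)//= expr2 lerDl; apply: sumr_ge0 => j _.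
by rewrite -expr2 sqr_ge0.
Qed.

Lemma enorm_ge0 x : 0 <= enorm x.
Proof. exact: sqrtr_ge0. Qed.

Lemma sqr_enorm x : enorm x ^+ 2 = dotv x x.
Proof. by rewrite sqr_sqrtr// dotv_ge0. Qed.

Lemma coord_le_enorm x i : `|x ord0 i| <= enorm x.
Proof. by rewrite -sqrtr_sqr ler_sqrt ?dotv_ge0// sqr_coord_le. Qed.

Lemma dotvv_eq0 x : dotv x x = 0 -> x = 0.
Proof.
move=> x0; apply/rowP => i; rewrite mxE; apply/eqP; rewrite -sqrf_eq0 eq_le.
by rewrite sqr_ge0 -x0 sqr_coord_le.
Qed.

Lemma enorm0 : enorm (0 : 'rV[R]_d) = 0.
Proof. by rewrite /enorm dotv0l sqrtr0. Qed.

Lemma enormZ (t : R) x : enorm (t *: x) = `|t| * enorm x.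
Proof. by rewrite /enorm dotvZl dotvZr mulrA -expr2 sqrtrM ?sqr_ge0// sqrtr_sqr. Qed.

Lemma enormN x : enorm (- x) = enorm x.
Proof. by rewrite -scaleN1r enormZ normrN1 mul1r. Qed.

(** Cauchy-Schwarz: the squared length of [(y.y) x - (x.y) y] is [y.y] times the difference of the
    squared sides. *)
Lemma dotv_le_enorm x y : `|dotv x y| <= enorm x * enorm y.
Proof.
rewrite -ler_sqr ?nnegrE ?mulr_ge0 ?enorm_ge0// real_normK ?num_real//.
rewrite exprMn !sqr_enorm.
have [c0|c0] := eqVneq (dotv y y) 0.
  by rewrite (dotvv_eq0 c0) !dotv0r mulr0 expr0n.
have cp : 0 < dotv y y by rewrite lt_neqAle eq_sym c0 dotv_ge0.
have := dotv_ge0 (dotv y y *: x - dotv x y *: y).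
rewrite dotvBl !dotvBr !dotvZl !dotvZr (dotvC y x) => h.
rewrite -subr_ge0 -(pmulr_rge0 _ cp); lra.
Qed.

Lemma ler_enormD x y : enorm (x + y) <= enorm x + enorm y.
Proof.
rewrite -ler_sqr ?nnegrE ?addr_ge0 ?enorm_ge0// sqrrD !sqr_enorm dotvDl !dotvDr.
have := ler_norm (dotv x y); have := dotv_le_enorm x y; rewrite (dotvC y x) => h1 h2.
have := le_trans h2 h1; lra.
Qed.

Lemma enorm_le_sum x : enorm x <= \sum_i `|x ord0 i|.
Proof.
have s0 : 0 <= \sum_i `|x ord0 i| by exact: sumr_ge0.
rewrite -ler_sqr ?nnegrE ?enorm_ge0// sqr_enorm expr2 mulr_suml.
apply: ler_sum => i _; rewrite -expr2 -real_normK ?num_real// expr2.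
by apply: ler_wpM2l => //; rewrite (bigD1 i)//= lerDl sumr_ge0.
Qed.

Lemma measurable_dotv d' (T : measurableType d') (D : set T)
    (f g : T -> 'rV[R]_d) :
  measurable_fun D f -> measurable_fun D g ->
  measurable_fun D (fun w => dotv (f w) (g w)).
Proof.
move=> mf mg; apply: measurable_sum => i.
by apply: measurable_funM; exact: measurable_fun_coord.
Qed.

Lemma measurable_enorm d' (T : measurableType d') (D : set T)
    (f : T -> 'rV[R]_d) :
  measurable_fun D f -> measurable_fun D (fun w => enorm (f w)).
Proof.
move=> mf; apply: (measurableT_comp (f := @Num.sqrt R)); last exact: measurable_dotv.
by apply: continuous_measurable_fun; exact: sqrt_continuous.
Qed.

Lemma measurable_rV_comb d' (T : measurableType d') (D : set T) (mD : measurable D)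
    (f g : T -> 'rV[R]_d) (t : R) :
  measurable_fun D f -> measurable_fun D g ->
  measurable_fun D (fun w => f w + t *: g w).
Proof.
move=> mf mg; apply: measurable_fun_rV_dom => // i.
under eq_fun do rewrite !mxE.
by apply: measurable_funD; [|apply: measurable_funM => //]; exact: measurable_fun_coord.
Qed.

End euclidean.

(** * Convex analysis *)

Section gradient.
Context {R : realType} {d : nat}.
Implicit Types (a b h s : 'rV[R]_d) (W phi : 'rV[R]_d -> R).

Lemma derive_egrad W a h : differentiable W a -> 'D_h W a = dotv (egrad W a) h.
Proof.
move=> dW; rewrite deriveE// {1}(row_sum_delta h) linear_sum/=.
apply: eq_bigr => i _; rewrite linearZ/= /egrad mxE /partial deriveE// mulrC.
by [].
Qed.

Lemma quotient_cvg W a h : differentiable W a ->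
  (fun t : R => t^-1 * (W (a + t *: h) - W a)) @ 0^'+ --> dotv (egrad W a) h.
Proof.
move=> dW; rewrite -derive_egrad//.
have := diff_derivable (v := h) dW; rewrite /derivable -/('D_h W a) => cv.
have {cv} : (fun t : R => t^-1 *: ((W \o shift a) (t *: h) - W a)) @ 0^' -->
  'D_h W a by exact: cv.
move=> cv; apply: cvg_dnbhs_at_right.
under eq_fun do rewrite [a + _]addrC.
exact: cv.
Qed.

Lemma le_egrad W a h c : differentiable W a ->
  (forall t : R, 0 < t <= 1 -> t * c <= W (a + t *: h) - W a) ->
  c <= dotv (egrad W a) h.
Proof.
move=> dW H; apply: (cvgr_to_ge (quotient_cvg (h := h) dW)).
near=> t; have t0 : 0 < t by near: t; exact: nbhs_right_gt.
rewrite mulrC ler_pdivlMr// mulrC; apply: H; rewrite t0/=.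
by near: t; apply: nbhs_right_le.
Unshelve. all: by end_near. Qed.

(** Convexity controls increments only for steps in []0, 1]]; this range suffices because the
    derivative is taken as a right limit. *)
Lemma egrad_le W a h c : differentiable W a ->
  (forall t : R, 0 < t <= 1 -> W (a + t *: h) - W a <= t * c) ->
  dotv (egrad W a) h <= c.
Proof.
move=> dW H; apply: (cvgr_to_le (quotient_cvg (h := h) dW)).
near=> t; have t0 : 0 < t by near: t; exact: nbhs_right_gt.
rewrite mulrC ler_pdivrMr// mulrC; apply: H; rewrite t0/=.
by near: t; apply: nbhs_right_le.
Unshelve. all: by end_near. Qed.

Lemma convex_grad_ineq W a b : differentiable W a -> convex_fun W ->
  W a + dotv (egrad W a) (b - a) <= W b.
Proof.
move=> dW cW; rewrite addrC -lerBrDr; apply: egrad_le => // t /andP[t0 t1].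
have := cW b a t; rewrite (ltW t0) t1 => /(_ isT).
rewrite (_ : t *: b + (1 - t) *: a = a + t *: (b - a)); last first.
  by apply/rowP => i; rewrite !mxE; ring.
by move=> h; lra.
Qed.

(** A subgradient lies below the directional derivative in every direction; using both [h] and [-h]
    leaves only the gradient. *)
Lemma subgradient_egrad W a s : differentiable W a ->
  (forall b, W a + dotv s (b - a) <= W b) -> s = egrad W a.
Proof.
move=> dW H.
have le h : dotv s h <= dotv (egrad W a) h.
  apply: le_egrad => // t _; have := H (a + t *: h).
  by rewrite addrAC subrr add0r dotvZr; lra.
apply/rowP => i; rewrite -!dotv_delta; apply/le_anti; rewrite le//=.
have := le (- delta_mx ord0 i); rewrite !(dotvC _ (- _)) !dotvNl !(dotvC (delta_mx _ _)).
by rewrite lerN2.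
Qed.

Lemma fenchel_ineq W s a : ((dotv s a - W a)%:E <= convex_conj W s)%E.
Proof. by apply: ereal_sup_ubound; exists a. Qed.

Lemma convex_conj_egrad W a : differentiable W a -> convex_fun W ->
  convex_conj W (egrad W a) = (dotv (egrad W a) a - W a)%:E.
Proof.
move=> dW cW; apply/le_anti; rewrite fenchel_ineq andbT.
apply: ge_ereal_sup => _ [b _ <-]; rewrite lee_fin.
have := convex_grad_ineq b dW cW; rewrite dotvBr; lra.
Qed.

(** Equality at [a] turns the Fenchel inequality at any other point [b] into the subgradient
    inequality at [a]. *)
Lemma fenchel_eq W s a : differentiable W a ->
  convex_conj W s = (dotv s a - W a)%:E -> s = egrad W a.
Proof.
move=> dW e; apply: subgradient_egrad => // b.
have := fenchel_ineq W s b; rewrite e lee_fin dotvBr; lra.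
Qed.

Lemma continuous_sum (T : topologicalType) (I : Type) (r : seq I) (P : pred I)
    (f : I -> T -> R) : (forall i, continuous (f i)) ->
  continuous (fun x => \sum_(i <- r | P i) f i x).
Proof.
move=> cf; elim: r => [|i r IH] x.
  by under eq_fun do rewrite big_nil; exact: cst_continuous.
under eq_fun do rewrite big_cons.
by case: ifP => _; [apply: cvgD; [exact: cf|exact: IH]|exact: IH].
Qed.

Lemma dotv_continuous s : continuous (dotv s).
Proof.
apply: continuous_sum => i x.
by apply: continuousM; [exact: cst_continuous|exact: coord_continuous].
Qed.

(** The conjugate is an uncountable supremum of affine functions, so measurability goes through
    lower semicontinuity: each superlevel set is a union of open sets, one for each affine
    function. *)
Lemma measurable_convex_conj W : measurable_fun setT (convex_conj W).
Proof.
apply: (measurability _ (ErealGenOInfty.measurableE R)) => _ [_ [c ->] <-].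
rewrite setTI; apply: open_measurable_rV.
rewrite (_ : _ @^-1` _ = \bigcup_x [set y | c < dotv y x - W x]).
  apply: bigcup_open => x _.
  rewrite (_ : [set _ | _] = (fun y => dotv x y - W x) @^-1` `]c, +oo[%classic).
    apply: open_comp; last exact: rray_open.
    by move=> y _; apply: continuousB; [exact: dotv_continuous|exact: cst_continuous].
  by apply/seteqP; split => y /=; rewrite in_itv/= andbT dotvC.
apply/seteqP; split => y /=; rewrite in_itv/= andbT.
  by move=> /ereal_sup_gt[_ [x _ <-]]; rewrite lte_fin => h; exists x.
by move=> [x _ h]; apply: lt_le_trans (fenchel_ineq W y x); rewrite lte_fin.
Qed.

End gradient.

(** * Lebesgue spaces *)

Section integral_monotone.
Local Open Scope ereal_scope.
Context d (T : measurableType d) (R : realType).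
Variable m : {measure set T -> \bar R}.

(* The integral is a difference of suprema over simple functions, and these are
   monotone on arbitrary functions. *)
Lemma le_integral_pointwise (D : set T) (f g : T -> \bar R) :
  (forall x, D x -> f x <= g x) ->
  \int[m]_(x in D) f x <= \int[m]_(x in D) g x.
Proof.
move=> fg; rewrite /integral; set f' := f \_ D; set g' := g \_ D.
have fg' x : f' x <= g' x.
  by rewrite /f' /g' !patchE; case: ifP => // /set_mem; exact: fg.
apply: leeB; apply: ge_ereal_sup => _ [h /= hf <-]; apply: ereal_sup_ubound;
  exists h => //= x; apply: le_trans (hf x) _.
  by rewrite !funeposE ge_max le_max fg'/= le_max lexx orbT.
by rewrite !funenegE ge_max le_max leeN2 fg'/= le_max lexx orbT.
Qed.

End integral_monotone.

Section powR_ineq.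
Context {R : realType}.
Implicit Types (a b p : R).

Lemma conj_exponent_gt1 p : 1 < p -> 1 < p / (p - 1).
Proof. by move=> p1; rewrite ltr_pdivlMr ?subr_gt0// mul1r gtrBl. Qed.

Lemma conj_exponentV p : 1 < p -> p^-1 + (p / (p - 1))^-1 = 1.
Proof. by move=> p1; field; apply/andP; split; lra. Qed.

Lemma young_powR a b p : 0 <= a -> 0 <= b -> 1 < p ->
  a * b <= a `^ p + b `^ (p / (p - 1)).
Proof.
move=> a0 b0 p1; have q1 := conj_exponent_gt1 p1.
apply: (le_trans (conjugate_powR a0 b0 _ _ (conj_exponentV p1))); try lra.
by apply: lerD; rewrite ler_pdivrMr ?ler_peMr ?powR_ge0//; lra.
Qed.

(** Young's inequality for [l^-1 * a] and [l * b]. The free parameter [l] makes the coefficient of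
    the second term as small as absorption requires. *)
Lemma young_powR_scaled a b p (l : R) : 0 <= a -> 0 <= b -> 1 < p -> 0 < l ->
  a * b <= (l^-1) `^ p * a `^ p + l `^ (p / (p - 1)) * b `^ (p / (p - 1)).
Proof.
move=> a0 b0 p1 l0; have l0' : 0 <= l by exact: ltW.
rewrite -!powRM ?invr_ge0// (_ : a * b = (l^-1 * a) * (l * b)).
  by apply: young_powR => //; rewrite mulr_ge0// invr_ge0.
by field; rewrite gt_eqF.
Qed.

(** The sum is at most twice the larger term. This is the origin of the factors [2 ^ p] in the
    estimates of linear combinations. *)
Lemma powRD_le a b p : 0 <= a -> 0 <= b -> 0 <= p ->
  (a + b) `^ p <= 2 `^ p * (a `^ p + b `^ p).
Proof.
move=> a0 b0 p0; wlog ab : a b a0 b0 / a <= b.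
  by move=> h; case: (leP a b) => [|/ltW] ab; [|rewrite addrC [X in _ * X]addrC]; exact: h.
apply: (@le_trans _ _ ((2 * b) `^ p)).
  by apply: ge0_ler_powR; rewrite ?nnegrE//; lra.
by rewrite powRM//; apply: ler_wpM2l; rewrite ?powR_ge0// lerDr powR_ge0.
Qed.

End powR_ineq.

Section lebesgue_lemmas.
Context {R : realType} {d : nat}.
Variable Omega : set 'rV[R]_d.
Hypothesis mO : measurable Omega.
Implicit Types (g h : 'rV[R]_d -> R) (G H : 'rV[R]_d -> 'rV[R]_d) (q : R).

Lemma Lpow_ge0 q g : (0 <= Lpow Omega q g)%E.
Proof. by apply: integral_ge0 => x _; rewrite lee_fin powR_ge0. Qed.

Lemma measurable_powR_norm q g : measurable_fun Omega g ->
  measurable_fun Omega (fun x => `|g x| `^ q).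
Proof.
by move=> mg; apply: (measurableT_comp (measurable_powR q)); exact: measurableT_comp.
Qed.

Lemma integrable_Lpow q g : in_Lp Omega q g ->
  (leb d).-integrable Omega (fun x => (`|g x| `^ q)%:E).
Proof.
move=> [mg gq]; apply/integrableP; split.
  by apply/measurable_EFinP; exact: measurable_powR_norm.
by under eq_integral do rewrite gee0_abs ?lee_fin ?powR_ge0//.
Qed.

Lemma in_LpP q g : measurable_fun Omega g ->
  (leb d).-integrable Omega (fun x => (`|g x| `^ q)%:E) -> in_Lp Omega q g.
Proof.
move=> mg /integrableP[_ h]; split => //; move: h.
by under eq_integral do rewrite gee0_abs ?lee_fin ?powR_ge0//.
Qed.

Lemma in_Lp_le q g h : 0 <= q -> measurable_fun Omega g -> in_Lp Omega q h ->
  (forall x, Omega x -> `|g x| <= `|h x|) -> in_Lp Omega q g.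
Proof.
move=> q0 mg [mh hq] gh; split => //; apply: le_lt_trans hq.
apply: le_integral_pointwise => x Ox; rewrite lee_fin.
by apply: ge0_ler_powR; rewrite ?nnegrE//; exact: gh.
Qed.

Lemma in_Lp_comb q g h (t : R) : 0 <= q -> in_Lp Omega q g -> in_Lp Omega q h ->
  in_Lp Omega q (fun x => g x + t * h x).
Proof.
move=> q0 Lg Lh; have [[mg _] [mh _]] := (Lg, Lh).
have ms : measurable_fun Omega (fun x => g x + t * h x).
  by apply: measurable_funD => //; apply: measurable_funM.
apply: in_LpP => //.
pose B x := 2 `^ q * (`|g x| `^ q + `|t| `^ q * (`|h x| `^ q)).
have iB : (leb d).-integrable Omega (fun x => (B x)%:E).
  rewrite /B; under eq_fun do rewrite EFinM EFinD EFinM.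
  apply: integrableZl => //; apply: integrableD => //; first exact: integrable_Lpow.
  by apply: integrableZl => //; exact: integrable_Lpow.
apply: le_integrable iB => //.
  by apply/measurable_EFinP; exact: measurable_powR_norm.
move=> x Ox; rewrite /= lee_fin [leLHS]ger0_norm ?powR_ge0// [leRHS]ger0_norm; last first.
  by rewrite /B mulr_ge0 ?addr_ge0 ?mulr_ge0 ?powR_ge0.
rewrite /B -(powRM _ (normr_ge0 _) (normr_ge0 _)).
apply: (@le_trans _ _ ((`|g x| + `|t| * `|h x|) `^ q)); last first.
  by apply: powRD_le => //; exact: mulr_ge0.
by apply: ge0_ler_powR; rewrite ?nnegrE ?addr_ge0 ?mulr_ge0// -normrM ler_normD.
Qed.

Lemma in_Lp_enorm q G : in_Lpv Omega q G -> in_Lp Omega q (fun x => enorm (G x)).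
Proof.
move=> [mG Gq]; split; first exact: measurable_enorm.
exact: Gq.
Qed.

Lemma in_LpvP q G : measurable_fun Omega G ->
  in_Lp Omega q (fun x => enorm (G x)) -> in_Lpv Omega q G.
Proof. by move=> mG [_ h]; split. Qed.

Lemma in_Lpv_comb q G H (t : R) : 0 <= q -> in_Lpv Omega q G -> in_Lpv Omega q H ->
  in_Lpv Omega q (fun x => G x + t *: H x).
Proof.
move=> q0 LG LH; have [[mG _] [mH _]] := (LG, LH).
apply: in_LpvP; first exact: measurable_rV_comb.
apply: (@in_Lp_le _ _ (fun x => enorm (G x) + `|t| * enorm (H x)) q0).
- by apply: measurable_enorm; exact: measurable_rV_comb.
- by apply: (in_Lp_comb _ q0); exact: in_Lp_enorm.
move=> x _; rewrite (ger0_norm (enorm_ge0 _)) ger0_norm; last first.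
  by apply: addr_ge0; rewrite ?mulr_ge0 ?enorm_ge0.
by rewrite -enormZ ler_enormD.
Qed.

Lemma in_Lp_bounded q g (B : R) : 0 <= q -> (leb d Omega < +oo)%E ->
  measurable_fun Omega g -> (forall x, Omega x -> `|g x| <= B) ->
  in_Lp Omega q g.
Proof.
move=> q0 Ofin mg gB; split => //.
apply: (@le_lt_trans _ _ (\int[leb d]_(x in Omega) (`|B| `^ q)%:E)%E).
  apply: le_integral_pointwise => x Ox; rewrite lee_fin.
  by apply: ge0_ler_powR; rewrite ?nnegrE//; exact: le_trans (gB x Ox) (ler_norm _).
by rewrite integral_cst// lte_mul_pinfty ?lee_fin ?powR_ge0.
Qed.

Lemma in_Lpv_bounded q G (B : R) : 0 <= q -> (leb d Omega < +oo)%E ->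
  measurable_fun Omega G -> (forall x, Omega x -> enorm (G x) <= B) ->
  in_Lpv Omega q G.
Proof.
move=> q0 Ofin mG GB; apply: in_LpvP => //.
apply: (@in_Lp_bounded _ _ B) => //; first exact: measurable_enorm.
by move=> x Ox; rewrite ger0_norm ?enorm_ge0//; exact: GB.
Qed.

Lemma integrable_mulLp p g h : 1 < p -> in_Lp Omega p g ->
  in_Lp Omega (p / (p - 1)) h ->
  (leb d).-integrable Omega (fun x => (g x * h x)%:E).
Proof.
move=> p1 Lg Lh; have [[mg _] [mh _]] := (Lg, Lh).
have i : (leb d).-integrable Omega
    (fun x => (`|g x| `^ p)%:E + (`|h x| `^ (p / (p - 1)))%:E)%E.
  by apply: integrableD => //; exact: integrable_Lpow.
apply: le_integrable i => //.
  by apply/measurable_EFinP; exact: measurable_funM.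
move=> x _; rewrite -EFinD/= lee_fin [leRHS]ger0_norm ?addr_ge0 ?powR_ge0//.
by rewrite normrM; exact: young_powR.
Qed.

Lemma integrable_dotvLp p G H : 1 < p -> in_Lpv Omega p G ->
  in_Lpv Omega (p / (p - 1)) H ->
  (leb d).-integrable Omega (fun x => (dotv (H x) (G x))%:E).
Proof.
move=> p1 LG LH.
have := integrable_mulLp p1 (in_Lp_enorm LG) (in_Lp_enorm LH).
apply: le_integrable => //.
  by apply/measurable_EFinP; apply: measurable_dotv; [have [] := LH|have [] := LG].
move=> x _; rewrite lee_fin [leRHS]ger0_norm ?mulr_ge0 ?enorm_ge0// mulrC.
exact: dotv_le_enorm.
Qed.

End lebesgue_lemmas.

(** * Continuous vector fields and polynomials *)

Section continuity.
Context {R : realType}.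

Lemma continuous_rV (T : topologicalType) n (f : T -> 'rV[R]_n) :
  (forall i, continuous (fun t => f t ord0 i)) -> continuous f.
Proof.
move=> cf x; apply/cvg_ballP => e e0.
have : \forall t \near x, forall i, ball (f x ord0 i) e (f t ord0 i).
  by apply: filter_forall => i; have /cvg_ballP := cf i x; exact.
by apply: filterS => t ft; split => // i j; rewrite (ord1 i).
Qed.

Lemma continuous_prod (T : topologicalType) (I : Type) (r : seq I) (P : pred I)
    (f : I -> T -> R) : (forall i, continuous (f i)) ->
  continuous (fun x => \prod_(i <- r | P i) f i x).
Proof.
move=> cf; elim: r => [|i r IH] x.
  by under eq_fun do rewrite big_nil; exact: cst_continuous.
under eq_fun do rewrite big_cons.
by case: ifP => _; [apply: continuousM; [exact: cf|exact: IH]|exact: IH].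
Qed.

(** [A] is enlarged to a closed ball, which is compact in finite dimension. *)
Lemma continuous_bounded_on d (A : set 'rV[R]_d) (g : 'rV[R]_d -> R) :
  continuous g -> bounded_set A -> exists B, forall x, A x -> `|g x| <= B.
Proof.
move=> cg /ex_strict_bound_gt0[b b0 Ab].
pose K := [set x : 'rV[R]_d | `|x| <= b].
have cK : compact K.
  apply: bounded_closed_compact.
    by exists b; split=> [|c bc x Kx]; [exact: num_real|exact: le_trans Kx (ltW bc)].
  by apply: closed_comp (@closed_le R b) => x _; exact: norm_continuous.
have cgK : compact (g @` K).
  by apply: continuous_compact => //; exact: continuous_subspaceT.
have /ex_strict_bound_gt0[B B0 HB] := compact_bounded cgK.
exists B => x Ax; apply: ltW; apply: (HB (g x)).
by exists x => //; apply: ltW; exact: Ab.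
Qed.

Lemma is_poly_continuous d k (q : 'rV[R]_d -> R) : is_poly k q -> continuous q.
Proof.
move=> [c qE]; rewrite (funext qE).
apply: continuous_sum => m x; apply: continuousM; first exact: cst_continuous.
apply: continuous_prod => i y.
exact: (continuous_comp (@coord_continuous R 1 d ord0 i y) (@exprn_continuous R (m i) _)).
Qed.

End continuity.

(** * Closed simplices and glued piecewise polynomials *)

Section hull_glue.
Context {R : realType} {n : nat}.
Variable M : mesh R n.+1.

(** The hull is the continuous image of the set [C] of barycentric coordinates, which is closed in
    the cube [[0, 1]^N] and hence compact. *)
Lemma hull_closed S : closed (hull (M := M) S).
Proof.
pose N := nvert M.
pose C := [set c : 'rV[R]_N | [/\ forall i, 0 <= c ord0 i,
  forall i, i \notin S -> c ord0 i = 0 & \sum_i c ord0 i = 1]].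
pose F := fun c : 'rV[R]_N => \sum_i c ord0 i *: vert M i.
have hE : hull S = F @` C.
  apply/seteqP; split => x.
    move=> [c [c0 cS c1 ->]]; exists (\row_i c i).
      by split => [i|i iS|]; rewrite ?mxE//; [exact: cS|under eq_bigr do rewrite mxE].
    by apply: eq_bigr => i _; rewrite mxE.
  by move=> [c [c0 cS c1] <-]; exists (c ord0).
have cC : compact C.
  apply: (subclosed_compact _ (@rV_compact R N (fun=> `[0, 1]%classic) _)).
  - rewrite (_ : C = (\bigcap_i [set c | 0 <= c ord0 i]) `&`
       (\bigcap_(i in [set i | i \notin S]) [set c | c ord0 i = 0]) `&`
       [set c | \sum_i c ord0 i = 1]); last first.
      apply/seteqP; split => [c [h1 h2 h3]|c [[h1 h2] h3]].
        by split; [split => [i _|i iS]; [exact: h1|exact: h2]|exact: h3].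
      by split; [move=> i; exact: h1|move=> i iS; exact: h2|exact: h3].
    apply: closedI; first apply: closedI.
    + apply: closed_bigI => i _.
      by apply: closed_comp (@closed_ge R 0) => x _; exact: coord_continuous.
    + apply: closed_bigI => i _.
      by apply: closed_comp (@closed_eq R 0) => x _; exact: coord_continuous.
    + apply: closed_comp (@closed_eq R 1) => x _.
      by apply: continuous_sum => i; exact: coord_continuous.
  - by move=> i; exact: segment_compact.
  - move=> c [c0 _ c1] i; rewrite /= in_itv/= c0/= -c1 (bigD1 i)//= lerDl.
    by apply: sumr_ge0 => j _; exact: c0.
rewrite hE; apply: compact_closed; first exact: norm_hausdorff.
apply: continuous_compact => //; apply: continuous_subspaceT.
apply: continuous_rV => j; rewrite /F.
under eq_fun do rewrite summxE.
apply: continuous_sum => i x; under eq_fun do rewrite mxE.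
by apply: continuousM; [exact: coord_continuous|exact: cst_continuous].
Qed.

Lemma measurable_hull S : measurable (hull (M := M) S).
Proof.
rewrite -[hull S]setCK; apply: measurableC; apply: open_measurable_rV.
by apply: closed_openC; exact: hull_closed.
Qed.

(** [pick] returns the first admissible cell of a fixed enumeration. Written with a list, the glued
    function is a cascade of case distinctions over the closed cells, open to induction on that
    list. *)
Lemma pw_glueE (v : {set 'I_(nvert M)} -> 'rV[R]_n.+1 -> R) x :
  pw_glue v x = if ohead [seq K <- Finite.enum {set 'I_(nvert M)} |
    (K \in cells M) && `[< hull K x >]] is Some K then v K x else 0.
Proof.
by rewrite /pw_glue /pick /enum_mem.
Qed.

Lemma measurable_pw_glue k (v : {set 'I_(nvert M)} -> 'rV[R]_n.+1 -> R) :
  Pk k v -> measurable_fun setT (pw_glue v).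
Proof.
move=> vP; rewrite (funext (pw_glueE v)).
elim: (Finite.enum _) => [|K s IH]; first exact: measurable_cst.
rewrite [X in measurable_fun _ X](_ : _ = fun x =>
  if (K \in cells M) && `[< hull K x >] then v K x else
  if ohead [seq K <- s | (K \in cells M) && `[< hull K x >]] is Some K
  then v K x else 0); last by apply/funext => x /=; case: ifP.
have [Kc|Kc] := boolP (K \in cells M); last first.
  by rewrite /=.
apply: measurable_fun_ifT => //=.
  apply: (@measurable_fun_bool _ _ setT _ true); rewrite setTI.
  rewrite (_ : _ @^-1` _ = hull K); first exact: measurable_hull.
  by apply/seteqP; split => x /= /asboolP.
by apply: continuous_measurable_rV; exact: is_poly_continuous (vP K Kc).
Qed.

Lemma pw_glue_bounded k (v : {set 'I_(nvert M)} -> 'rV[R]_n.+1 -> R)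
    (A : set 'rV[R]_n.+1) : Pk k v -> bounded_set A ->
  exists B, forall x, A x -> `|pw_glue v x| <= B.
Proof.
move=> vP bA.
have /choice[B HB] : forall K, exists B, K \in cells M ->
    forall x, A x -> `|v K x| <= B.
  move=> K; have [Kc|Kc] := boolP (K \in cells M); last by exists 0.
  have [B HB] := continuous_bounded_on (is_poly_continuous (vP K Kc)) bA.
  by exists B.
exists (\sum_K `|B K|) => x Ax; rewrite /pw_glue; case: pickP => [K|_]; last first.
  by rewrite normr0 sumr_ge0.
move=> /andP[Kc _]; apply: (le_trans (HB K Kc x Ax)).
by rewrite (bigD1 K)//= (le_trans (ler_norm _))// lerDl sumr_ge0.
Qed.

End hull_glue.

(** * Integration by parts *)

Section integral_partial.
Context {R : realType}.

Lemma bounded_support_integrable d (T : measurableType d)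
    (m : {measure set T -> \bar R}) (A : set T) (g : T -> R) (B : R) :
  measurable A -> (m A < +oo)%E -> measurable_fun setT g ->
  (forall x, A x -> `|g x| <= B) -> (forall x, ~ A x -> g x = 0) ->
  m.-integrable setT (EFin \o g).
Proof.
move=> mA Afin mg gB g0.
have : m.-integrable A (EFin \o g).
  apply: measurable_bounded_integrable => //; first exact: measurable_funTS.
  by exists B; split => [|b Bb x Ax]; [exact: num_real|exact: le_trans (gB x Ax) (ltW Bb)].
rewrite integrable_mkcond// (_ : _ \_ _ = EFin \o g)//.
apply/funext => x; rewrite patchE; case: ifPn => // /negP xA /=.
by rewrite g0// => /mem_set.
Qed.

Lemma continuous_rvconsl n (y : 'rV[R]_n) : continuous (fun t => rvcons (t, y)).
Proof.
apply: continuous_rV => i; rewrite /rvcons; under eq_fun do rewrite mxE.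
case: (unlift ord0 i) => [j|]; first exact: cst_continuous.
by move=> x.
Qed.

Lemma continuous_rvconsr n (t : R) : continuous (fun y : 'rV[R]_n => rvcons (t, y)).
Proof.
apply: continuous_rV => i; rewrite /rvcons; under eq_fun do rewrite mxE.
by case: (unlift ord0 i) => [j|]; [exact: coord_continuous|exact: cst_continuous].
Qed.

(** Together with the next lemma, this identifies difference quotients along a coordinate axis with
    those of a slice in which the first coordinate, or all the others, are frozen. *)
Lemma rvcons_shiftl n (t h : R) (y : 'rV[R]_n) :
  rvcons (h + t, y) = h *: delta_mx ord0 ord0 + rvcons (t, y).
Proof.
apply/rowP => i; rewrite !mxE; case: (unliftP ord0 i) => [j|] ->.
  rewrite (_ : (lift ord0 j == ord0) = false); last by [].
  by rewrite andbF mulr0 add0r.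
by rewrite !eqxx mulr1.
Qed.

Lemma rvcons_shiftr n (t h : R) (j : 'I_n) (y : 'rV[R]_n) :
  rvcons (t, h *: delta_mx ord0 j + y) =
  h *: delta_mx ord0 (lift ord0 j) + rvcons (t, y).
Proof.
apply/rowP => i; rewrite !mxE; case: (unliftP ord0 i) => [k|] ->.
  by rewrite /= !mxE (inj_eq (@lift_inj _ _)).
rewrite (_ : (ord0 == lift ord0 j) = false); last by [].
by rewrite andbF mulr0 add0r.
Qed.

(** Induction on the dimension, splitting off the first coordinate by Fubini. If [i] is a later
    coordinate, the integral over the remaining variables vanishes by induction. If [i] is the first
    one, the inner integral is a difference of values of [g] at [b] and [-b], where [g] is zero.
    Only the derivative in direction [i] is mentioned, so that the hypotheses pass to slices. *)
Lemma integral_partial_eq0 d (i : 'I_d) (g : 'rV[R]_d -> R) (b : R) : 0 < b ->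
  continuous g -> (forall x, derivable g x (delta_mx ord0 i)) ->
  continuous (partial i g) ->
  (forall x : 'rV[R]_d, (exists j, b <= `|x ord0 j|) -> g x = 0 /\ partial i g x = 0) ->
  (\int[leb d]_x (partial i g x)%:E = 0)%E.
Proof.
move=> b0; elim: d i g => [[]//|d IH] i g cg dg cD g0.
pose D := partial i g; pose D2 z := D (@rvcons R d z).
pose A := [set x : 'rV[R]_d.+1 | forall i, `|x ord0 i - 0| < b].
have mA : measurable A by exact: measurable_rV_box.
have Afin : (leb d.+1 A < +oo)%E by exact: leb_box_lty.
have bA : bounded_set A.
  exists b; split => [|c bc x Ax]; first exact: num_real.
  rewrite /Num.norm/= mx_normrE; apply/bigmax_leP; split; first lra.
  by move=> [k j] _ /=; rewrite (ord1 k); have := Ax j; rewrite subr0; lra.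
have [B DB] := continuous_bounded_on cD bA.
have D0 x : ~ A x -> D x = 0.
  move=> /existsNP[j /negP]; rewrite subr0 -leNgt => xj.
  by have [] := g0 x (ex_intro _ j xj).
have mD : measurable_fun setT D by exact: continuous_measurable_rV.
have mD2 : measurable_fun setT D2 by exact: (measurableT_comp mD (@measurable_rvcons R d)).
have iD2 : ((@lebesgue_measure R) \x leb d)%E.-integrable setT (EFin \o D2).
  apply: (bounded_support_integrable
    (m := ((@lebesgue_measure R) \x leb d)%E : {measure set _ -> \bar R})
    (A := @rvcons R d @^-1` A) (B := B)) => //.
  - by rewrite -[X in measurable X]setTI; exact: measurable_rvcons.
  - by move=> z Az; exact: DB.
  - by move=> z Az; exact: D0.
(* [leb d.+1] is the image under [rvcons] of the product measure, so the integral moves to the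
   product, where Fubini applies. *)
have -> : (\int[leb d.+1]_x (partial i g x)%:E =
    \int[(@lebesgue_measure R) \x leb d]_z (EFin \o D2) z)%E.
  pose pm := ((@lebesgue_measure R) \x leb d)%E : {measure set _ -> \bar R}.
  have h : measurable_fun setT (EFin \o D) by exact/measurable_EFinP.
  have mrc : measurable_fun [set: measurableTypeR R * 'rV[R]_d] (@rvcons R d).
    exact: (@measurable_rvcons R d).
  exact: (integral_pushforward mrc (mu := pm) (D := setT) h iD2 measurableT).
have ncons0 t y : b <= `|t| -> D2 (t, y) = 0 /\ g (rvcons (t, y)) = 0.
  move=> bt; suff /g0[] : exists j, b <= `|rvcons (t, y) ord0 j| by [].
  by exists ord0; rewrite /rvcons mxE unlift_none.
case: (unliftP ord0 i) => [j|] ie.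
  rewrite -integral12_prod_meas1//; apply: integral0_eq => t _.
  rewrite /fubini_F.
  pose gt y := g (rvcons (t, y)).
  have quot y h : (gt \o shift y) (h *: delta_mx ord0 j) =
      (g \o shift (rvcons (t, y))) (h *: delta_mx ord0 i).
    by rewrite /gt/= rvcons_shiftr ie.
  have pE y : partial j gt y = D2 (t, y).
    by rewrite /partial /derive; under eq_fun do rewrite quot.
  under eq_integral do rewrite /= -pE.
  apply: IH.
  - by move=> y; exact: (continuous_comp (@continuous_rvconsr d t y) (cg _)).
  - move=> y; rewrite /derivable; under eq_fun do rewrite quot.
    exact: dg.
  - rewrite (funext pE).
    by move=> y; exact: (continuous_comp (@continuous_rvconsr d t y) (cD _)).
  - move=> y [k bk]; rewrite pE.
    have [] : g (rvcons (t, y)) = 0 /\ partial i g (rvcons (t, y)) = 0; last by [].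
    by apply: g0; exists (lift ord0 k); rewrite /rvcons mxE liftK.
rewrite -integral21_prod_meas1//; apply: integral0_eq => y _.
rewrite /fubini_G.
pose G : R -> R^o := fun t => g (rvcons (t, y)).
have quot (t h : R^o) : ((G : R^o -> R^o) \o shift t) (h *: 1) =
    (g \o shift (rvcons (t, y))) (h *: delta_mx ord0 i).
  by rewrite /G/= [h *: 1]mulr1 rvcons_shiftl ie.
have dG (t : R^o) : derivable (G : R^o -> R^o) t 1.
  by rewrite /derivable; under eq_fun do rewrite quot; exact: dg.
have G'E (t : R) : (G^`())%classic t = D2 (t, y).
  by rewrite derive1E /derive; under eq_fun do rewrite quot.
have cG : continuous G.
  by move=> t; exact: (continuous_comp (@continuous_rvconsl d y t) (cg _)).
have cD2 : continuous (fun t => D2 (t, y)).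
  by move=> t; exact: (continuous_comp (@continuous_rvconsl d y t) (cD _)).
transitivity (\int[@lebesgue_measure R]_(t in `[(- b)%R, b]) (D2 (t : R, y))%:E)%E.
  rewrite [RHS]integral_mkcond; apply: eq_integral => t _.
  rewrite patchE; case: ifPn => // /negP tb.
  rewrite /= (ncons0 _ _ _).1// leNgt; apply/negP => tb'; apply: tb; apply/mem_set.
  by rewrite /= in_itv/= -ler_norml ltW.
have LR : derivable_oo_LRcontinuous G (- b) b.
  split; first by move=> t _; exact: dG.
    by apply: cvg_at_right_filter; exact: cG.
  by apply: cvg_at_left_filter; exact: cG.
have wc : {within `[(- b), b], continuous (fun t => D2 (t, y))}.
  exact: continuous_subspaceT.
have bb : - b < b by lra.
have G'E' : {in `]- b, b[, (G^`())%classic =1 (fun t => D2 (t, y))} by move=> t _.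
rewrite (continuous_FTC2 bb wc LR G'E').
have Gb t : b <= `|t| -> G t = 0 by move=> /(ncons0 t y)[].
by rewrite !Gb ?normrN ?ger0_norm ?sube0//; lra.
Qed.

End integral_partial.

(** * Sobolev spaces *)

Section ereal_null_sequences.
Context {R : realType}.
Implicit Types (x y z : nat -> \bar R) (q : R).

Lemma cvge0_ltP x : (forall j, 0 <= x j)%E ->
  (x @ \oo --> 0%E) <-> forall e : R, 0 < e -> \forall j \near \oo, (x j < e%:E)%E.
Proof.
move=> x0; split.
  move=> /fine_cvgP[xfin /cvgrPdist_lt cx] e e0.
  near=> j; have xj : x j \is a fin_num by near: j; exact: xfin.
  rewrite -(fineK xj) lte_fin; apply: le_lt_trans (ler_norm _) _.
  rewrite -normrN -[- _]add0r.
  by near: j; exact: (cx e e0).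
move=> H; apply/fine_cvgP; split.
  near=> j; rewrite ge0_fin_numE//.
  by apply: (@lt_trans _ _ 1%:E); [near: j; exact: H|exact: ltry].
apply/cvgrPdist_lt => e e0; near=> j.
have xj : (x j < e%:E)%E by near: j; exact: H.
rewrite sub0r normrN ger0_norm ?fine_ge0//.
by rewrite -lte_fin fineK// ge0_fin_numE// (lt_trans xj) ?ltry.
Unshelve. all: by end_near. Qed.

(** Convergence in [W1pnorm] can be tested without the outer root; the underlying sums of power
    integrals are what linear combinations can be estimated with. *)
Lemma cvge0_poweR x q : 0 < q -> (forall j, 0 <= x j)%E ->
  ((fun j => x j `^ q^-1)%E @ \oo --> 0%E) <-> (x @ \oo --> 0%E).
Proof.
move=> q0 x0; have px0 j : (0 <= x j `^ q^-1)%E by exact: poweR_ge0.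
have qV : 0 <= q^-1 by rewrite invr_ge0 ltW.
split=> [/(cvge0_ltP px0) H|/(cvge0_ltP x0) H].
  apply/cvge0_ltP => // e e0; have := H (e `^ q^-1) (powR_gt0 _ e0).
  apply: filterS => j; rewrite !ltNge; apply: contra => ex.
  rewrite -poweR_EFin; apply: gt0_ler_poweR => //.
    by rewrite in_itv/= lee_fin ltW ?leey.
  by rewrite in_itv/= x0 leey.
apply/(cvge0_ltP px0) => e e0; have e20 : 0 < e / 2 by lra.
have := H ((e / 2) `^ q) (powR_gt0 _ e20).
apply: filterS => j xj; apply: (@le_lt_trans _ _ (e / 2)%:E); last by rewrite lte_fin; lra.
rewrite [leRHS](_ : _ = (((e / 2) `^ q)%:E `^ q^-1)%E); last first.
  by rewrite poweR_EFin -powRrM mulfV ?gt_eqF// powRr1// ltW.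
apply: gt0_ler_poweR => //.
- by rewrite in_itv/= x0 leey.
- by rewrite in_itv/= lee_fin powR_ge0 leey.
- exact: ltW.
Qed.

Lemma cvge0_comb x y z (a b : R) : (forall j, 0 <= z j)%E ->
  (forall j, z j <= a%:E * x j + b%:E * y j)%E ->
  x @ \oo --> 0%E -> y @ \oo --> 0%E -> z @ \oo --> 0%E.
Proof.
move=> z0 zxy cx cy.
have c : (fun j => a%:E * x j + b%:E * y j)%E @ \oo --> 0%E.
  rewrite -[X in _ --> X](_ : a%:E * 0 + b%:E * 0 = 0)%E; last first.
    by rewrite !mule0 adde0.
  by apply: cvgeD; [rewrite !mule0|exact: cvgeZl|exact: cvgeZl].
apply: squeeze_cvge c => //; last exact: cvg_cst.
by apply: nearW => j; rewrite z0/= zxy.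
Qed.

End ereal_null_sequences.

Section sobolev.
Context {R : realType}.

(** The measure is arbitrary because the estimate serves twice: for the Lebesgue measure on [Omega]
    and for the surface measure in the definition of the trace. *)
Lemma Lq_comb_le d (T : measurableType d) (m : {measure set T -> \bar R})
    (D : set T) (g h a : T -> R) (q t : R) : measurable D -> 0 <= q ->
  measurable_fun D g -> measurable_fun D h ->
  (forall x, D x -> `|a x| <= `|g x| + `|t| * `|h x|) ->
  (\int[m]_(x in D) (`|a x| `^ q)%:E <=
   (2 `^ q)%:E * (\int[m]_(x in D) (`|g x| `^ q)%:E) +
   (2 `^ q * `|t| `^ q)%:E * (\int[m]_(x in D) (`|h x| `^ q)%:E))%E.
Proof.
move=> mD q0 mg mh agh.
have mpow (k : T -> R) : measurable_fun D k ->
    measurable_fun D (fun x => (`|k x| `^ q)%:E).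
  move=> mk; apply/measurable_EFinP; apply: (measurableT_comp (measurable_powR q)).
  exact: measurableT_comp.
have pow0 (k : T -> R) x : D x -> (0 <= (`|k x| `^ q)%:E)%E.
  by move=> _; rewrite lee_fin powR_ge0.
rewrite -!ge0_integralZl ?lee_fin ?mulr_ge0 ?powR_ge0//; try exact: mpow; try exact: pow0.
rewrite -ge0_integralD//.
- apply: le_integral_pointwise => x Dx; rewrite -!EFinM -EFinD lee_fin.
  rewrite -mulrA -mulrDr -(powRM _ (normr_ge0 _) (normr_ge0 _)).
  apply: (@le_trans _ _ ((`|g x| + `|t| * `|h x|) `^ q)); last first.
    by apply: powRD_le => //; exact: mulr_ge0.
  by apply: ge0_ler_powR; rewrite ?nnegrE ?addr_ge0 ?mulr_ge0//; exact: agh.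
- by apply: emeasurable_funM => //; exact: mpow.
- by apply: emeasurable_funM => //; exact: mpow.
Qed.

Context {d : nat}.
Variables (Omega : set 'rV[R]_d).
Hypotheses (oO : open Omega) (bO : bounded_set Omega).
Implicit Types (phi psi : 'rV[R]_d -> R).

Let mO : measurable Omega. Proof. exact: open_measurable_rV. Qed.
Let finO : (leb d Omega < +oo)%E. Proof. exact: bounded_leb_lty. Qed.

Lemma continuous_in_Lp q phi : 0 <= q -> continuous phi -> in_Lp Omega q phi.
Proof.
move=> q0 cphi; have [B HB] := continuous_bounded_on cphi bO.
by apply: (in_Lp_bounded mO q0 finO _ HB); exact: continuous_measurable_rV.
Qed.

Lemma continuous_enorm_bounded (G : 'rV[R]_d -> 'rV[R]_d) (A : set 'rV[R]_d) :
  continuous G -> bounded_set A -> exists B, forall x, A x -> enorm (G x) <= B.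
Proof.
move=> cG bA; have cGi i : continuous (fun x => G x ord0 i).
  by move=> x; exact: (continuous_comp (cG x) (@coord_continuous R 1 d ord0 i (G x))).
have /choice[B HB] i := continuous_bounded_on (cGi i) bA.
exists (\sum_i B i) => x Ax; apply: (le_trans (enorm_le_sum _)).
by apply: ler_sum => i _; exact: HB.
Qed.

Lemma continuous_in_Lpv q (G : 'rV[R]_d -> 'rV[R]_d) : 0 <= q -> continuous G ->
  in_Lpv Omega q G.
Proof.
move=> q0 cG; have [B HB] := continuous_enorm_bounded cG bO.
by apply: (in_Lpv_bounded mO q0 finO _ HB); exact: continuous_measurable_rVv.
Qed.

Lemma smooth_continuous phi : smooth phi -> continuous phi.
Proof. by move=> sphi x; apply: differentiable_continuous; exact: (sphi [::]). Qed.

Lemma smooth_partial_continuous phi i : smooth phi -> continuous (partial i phi).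
Proof. by move=> sphi x; apply: differentiable_continuous; exact: (sphi [:: i]). Qed.

Lemma smooth_C1 phi : smooth phi -> C1 phi.
Proof.
move=> sphi; split; first by move=> x; exact: (sphi [::]).
apply: continuous_rV => i; rewrite /egrad; under eq_fun do rewrite mxE.
exact: smooth_partial_continuous.
Qed.

Lemma egrad_comb phi psi (t : R) x : differentiable phi x -> differentiable psi x ->
  egrad (fun y => phi y + t * psi y) x = egrad phi x + t *: egrad psi x.
Proof.
move=> dphi dpsi; apply/rowP => i; rewrite !mxE /partial.
have h1 : derivable phi x (delta_mx ord0 i) by exact: diff_derivable.
have h2 : derivable psi x (delta_mx ord0 i) by exact: diff_derivable.
have h3 : derivable (t \*: psi) x (delta_mx ord0 i) by exact: derivableZ.
exact: (etrans (deriveD h1 h3) (congr1 (+%R _) (deriveZ t h2))).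
Qed.

Lemma C1_comb phi psi (t : R) : C1 phi -> C1 psi -> C1 (fun y => phi y + t * psi y).
Proof.
move=> [dphi cphi] [dpsi cpsi]; split.
  move=> x; rewrite (_ : (fun y => _) = phi + t \*: psi)//.
  by apply: differentiableD => //; exact: differentiableZ.
rewrite (_ : egrad _ = fun x => egrad phi x + t *: egrad psi x); last first.
  by apply/funext => x; exact: egrad_comb.
apply: continuous_rV => i x; under eq_fun do rewrite !mxE.
have c f : continuous (egrad f) -> {for x, continuous (partial i f)}.
  move=> cf; have := continuous_comp (cf x) (@coord_continuous R 1 d ord0 i (egrad f x)).
  by rewrite (_ : _ \o _ = partial i f)//; apply/funext => y; rewrite /= mxE.
apply: (@continuousD _ _ _ (partial i phi) (fun y => t * partial i psi y)).
  exact: c.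
by apply: continuousM; [exact: cst_continuous|exact: c].
Qed.

End sobolev.

Section sobolev_space.
Context {R : realType} {d : nat}.
Variables (Omega : set 'rV[R]_d) (p : R).
Hypotheses (oO : open Omega) (bO : bounded_set Omega) (p1 : 1 < p).
Variables (mu : {measure set 'rV[R]_d -> \bar R}) (GammaD : set 'rV[R]_d).
Implicit Types (phi psi : 'rV[R]_d -> R) (u v : W1p Omega p).

Let mO : measurable Omega. Proof. exact: open_measurable_rV. Qed.
Let p0 : 0 <= p. Proof. by rewrite ltW// (lt_trans ltr01). Qed.
Let p'0 : 0 <= p / (p - 1). Proof. by rewrite divr_ge0// subr_ge0 ltW. Qed.

Lemma integrable_mul_continuous g phi : in_Lp Omega p g -> continuous phi ->
  (leb d).-integrable Omega (fun x => (g x * phi x)%:E).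
Proof.
move=> Lg cphi; apply: (integrable_mulLp mO p1 Lg).
exact: continuous_in_Lp.
Qed.

Lemma in_Lpv_coord (G : 'rV[R]_d -> 'rV[R]_d) i : in_Lpv Omega p G ->
  in_Lp Omega p (fun x => G x ord0 i).
Proof.
move=> LG; apply: (in_Lp_le p0 _ (in_Lp_enorm LG)).
  by apply: measurable_fun_coord; have [] := LG.
by move=> x _; rewrite [leRHS]ger0_norm ?enorm_ge0// coord_le_enorm.
Qed.

Lemma intO_comb (a b : 'rV[R]_d -> R) (t : R) :
  (leb d).-integrable Omega (EFin \o a) -> (leb d).-integrable Omega (EFin \o b) ->
  intO Omega (fun x => a x + t * b x) = intO Omega a + t * intO Omega b.
Proof.
move=> ia ib; rewrite /intO RintegralD//; last first.
  by apply: (eq_integrable mO) (integrableZl mO t ib) => x _ /=; rewrite EFinM.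
by rewrite RintegralZl.
Qed.

(** An element of [W1p] bundles representatives with proofs, so a linear combination is rebuilt as a
    record. Equalities of functions, rather than almost everywhere, let later integrals be rewritten
    directly. *)
Lemma W1p_comb u v (t : R) : exists w : W1p Omega p,
  (w = (fun x => u x + t * v x) :> ('rV[R]_d -> R)) /\
  wgrad w = (fun x => wgrad u x + t *: wgrad v x).
Proof.
have Lf := in_Lp_comb mO t p0 (wfun_Lp u) (wfun_Lp v).
have LG := in_Lpv_comb mO t p0 (wgrad_Lp u) (wgrad_Lp v).
have wP phi i : test_fun Omega phi ->
    intO Omega (fun x => (u x + t * v x) * partial i phi x) =
    - intO Omega (fun x => (wgrad u x + t *: wgrad v x) ord0 i * phi x).
  move=> tphi; have [sphi _] := tphi.
  have cp := smooth_partial_continuous (i := i) sphi.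
  have c := smooth_continuous sphi.
  have iu := integrable_mul_continuous (wfun_Lp u) cp.
  have iv := integrable_mul_continuous (wfun_Lp v) cp.
  have iGu := integrable_mul_continuous (in_Lpv_coord i (wgrad_Lp u)) c.
  have iGv := integrable_mul_continuous (in_Lpv_coord i (wgrad_Lp v)) c.
  transitivity (intO Omega (fun x => u x * partial i phi x) +
      t * intO Omega (fun x => v x * partial i phi x)).
    by rewrite -intO_comb//; apply: eq_Rintegral => x _; ring.
  rewrite !(wgradP _ i tphi) mulrN -opprD; congr (- _).
  by rewrite -intO_comb//; apply: eq_Rintegral => x _; rewrite !mxE; ring.
by exists (Build_W1p Lf LG wP).
Qed.

Let W1p_error (phi : nat -> 'rV[R]_d -> R) v j :=
  (Lpow Omega p (fun x => (phi j x - v x)%R) +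
   Lpow Omega p (enorm \o (fun x => (egrad (phi j) x - wgrad v x)%R)))%E.

(** The combined approximants [phi j + t * psi j] serve: both their error in [Omega] and their error
    on the boundary are bounded by fixed multiples of the two given errors. *)
Lemma is_trace_comb u v (w : W1p Omega p) g h (t : R) :
  (w = (fun x => u x + t * v x) :> ('rV[R]_d -> R)) ->
  wgrad w = (fun x => wgrad u x + t *: wgrad v x) ->
  is_trace mu u g -> is_trace mu v h ->
  is_trace (Omega := Omega) (q := p) mu w (fun x => g x + t * h x).
Proof.
move=> wE GwE [mg [phi [Cphi cphi tphi]]] [mh [psi [Cpsi cpsi tpsi]]].
have pp : 0 < p by rewrite (lt_trans ltr01).
have mC1 (D : set 'rV[R]_d) f : C1 f -> measurable_fun D f.
  move=> [df _]; apply: continuous_measurable_rV => x.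
  exact: differentiable_continuous.
have mC1g (D : set 'rV[R]_d) f : C1 f -> measurable_fun D (egrad f).
  by move=> [_ cf]; exact: continuous_measurable_rVv.
have e0 f z j : (0 <= W1p_error f z j)%E by rewrite adde_ge0 ?Lpow_ge0.
split; first by apply: measurable_funD => //; exact: measurable_funM.
exists (fun j x => phi j x + t * psi j x); split.
- by move=> j; exact: C1_comb.
- move/(cvge0_poweR pp (e0 _ _)) : cphi => cphi.
  move/(cvge0_poweR pp (e0 _ _)) : cpsi => cpsi.
  apply/(cvge0_poweR pp) => [j|]; first by rewrite adde_ge0 ?Lpow_ge0.
  apply: (cvge0_comb (a := 2 `^ p) (b := 2 `^ p * `|t| `^ p) _ _ cphi cpsi).
    by move=> j; rewrite adde_ge0 ?Lpow_ge0.
  move=> j; rewrite /W1p_error.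
  rewrite (ge0_muleDr _ (Lpow_ge0 _ _ _) (Lpow_ge0 _ _ _)).
  rewrite (ge0_muleDr _ (Lpow_ge0 _ _ _) (Lpow_ge0 _ _ _)) [leRHS]addeACA.
  have [[mu1 _] [mv1 _]] := (wfun_Lp u, wfun_Lp v).
  have [[mGu _] [mGv _]] := (wgrad_Lp u, wgrad_Lp v).
  apply: leeD; apply: Lq_comb_le => //.
  + by apply: measurable_funB => //; exact: mC1.
  + by apply: measurable_funB => //; exact: mC1.
  + move=> x _; rewrite wE -normrM (le_trans _ (ler_normD _ _))//.
    by rewrite le_eqVlt; apply/orP; left; apply/eqP; congr (`|_|); ring.
  + apply: measurable_enorm; under eq_fun do rewrite -scaleN1r.
    by apply: measurable_rV_comb => //; exact: mC1g.
  + apply: measurable_enorm; under eq_fun do rewrite -scaleN1r.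
    by apply: measurable_rV_comb => //; exact: mC1g.
  + move=> x _; rewrite /= GwE egrad_comb; [|by have [] := Cphi j|by have [] := Cpsi j].
    rewrite !(ger0_norm (enorm_ge0 _)) -enormZ (le_trans _ (ler_enormD _ _))//.
    rewrite le_eqVlt; apply/orP; left; apply/eqP; congr enorm.
    by apply/rowP => i; rewrite !mxE; ring.
- apply: (cvge0_comb (a := 2 `^ p) (b := 2 `^ p * `|t| `^ p) _ _ tphi tpsi).
    by move=> j; apply: integral_ge0 => x _; rewrite lee_fin powR_ge0.
  move=> j; apply: Lq_comb_le => //.
  + by apply: measurable_funB => //; exact: mC1.
  + by apply: measurable_funB => //; exact: mC1.
  + move=> x _; rewrite -normrM (le_trans _ (ler_normD _ _))//.
    by rewrite le_eqVlt; apply/orP; left; apply/eqP; congr (`|_|); ring.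
Qed.

Lemma W1pD_comb (u v : W1pD Omega p mu GammaD) (t : R) :
  exists w : W1pD Omega p mu GammaD,
  (w = (fun x => u x + t * v x) :> ('rV[R]_d -> R)) /\
  wgrad w = (fun x => wgrad u x + t *: wgrad v x).
Proof.
have [w [wE GwE]] := W1p_comb u v t.
have [g tg g0] := zero_trace u; have [h th h0] := zero_trace v.
have zt : exists2 k, is_trace mu w k & {ae mu, forall x, GammaD x -> k x = 0}.
  exists (fun x => g x + t * h x); first exact: (is_trace_comb wE GwE tg th).
  by apply: filterS2 g0 h0 => x gx hx Gx; rewrite gx// hx// mulr0 addr0.
by exists (Build_W1pD zt).
Qed.

(** The product of the two functions vanishes off the bounded set [Omega], so the integral of its
    derivative over the whole space is zero; the product rule splits it into the two terms. *)
Lemma test_fun_ibp phi psi i : test_fun Omega phi -> test_fun Omega psi ->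
  intO Omega (fun x => phi x * partial i psi x) =
  - intO Omega (fun x => partial i phi x * psi x).
Proof.
move=> [sphi [K [cK KO phi0]]] [spsi [K' [cK' K'O psi0]]].
have c1 := smooth_continuous sphi; have c2 := smooth_continuous spsi.
have d1 := smooth_partial_continuous (i := i) sphi.
have d2 := smooth_partial_continuous (i := i) spsi.
pose g x := phi x * psi x.
have h1 x : derivable phi x (delta_mx ord0 i) by apply: diff_derivable; exact: (sphi [::]).
have h2 x : derivable psi x (delta_mx ord0 i) by apply: diff_derivable; exact: (spsi [::]).
have gE x : partial i g x = phi x * partial i psi x + psi x * partial i phi x.
  exact: (deriveM (h1 x) (h2 x)).
have [b b0 Ob] := ex_strict_bound_gt0 bO.
(* Off [Omega] both factors vanish, so the product rule alone makes the derivative of [g] zero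
   there. *)
have g0 x : ~ Omega x -> g x = 0 /\ partial i g x = 0.
  move=> xO; have px0 : phi x = 0 by apply: phi0 => /KO.
  have qx0 : psi x = 0 by apply: psi0 => /K'O.
  by rewrite gE /g px0 qx0 !mul0r addr0.
have I0 : (\int[leb d]_x (partial i g x)%:E = 0)%E.
  apply: (integral_partial_eq0 (b := b)) => //.
  - by move=> x; exact: (continuousM (c1 x) (c2 x)).
  - by move=> x; exact: (derivableM (h1 x) (h2 x)).
  - rewrite (funext gE) => x.
    apply: (@continuousD _ _ _ (fun y => phi y * partial i psi y)
      (fun y => psi y * partial i phi y)).
      exact: (continuousM (c1 x) (d2 x)).
    exact: (continuousM (c2 x) (d1 x)).
  - move=> x [j bj]; apply: g0 => Ox; have /= xb := Ob x Ox.
    by have := le_lt_trans (le_trans bj (coord_le_norm x j)) xb; rewrite ltxx.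
have i1 := integrable_mul_continuous (continuous_in_Lp oO bO p0 c1) d2.
have i2 := integrable_mul_continuous (continuous_in_Lp oO bO p0 d1) c2.
apply/eqP; rewrite -addr_eq0 /intO -RintegralD//; apply/eqP.
transitivity (fine (\int[leb d]_x (partial i g x)%:E)%E); last by rewrite I0.
rewrite /Rintegral integral_mkcond; congr fine; apply: eq_integral => x _.
rewrite patchE; case: ifPn => [_|/negP xO]; first by rewrite gE [psi x * _]mulrC.
by rewrite (g0 x _).2// => /mem_set.
Qed.

Hypothesis GammaD_bd : GammaD `<=` bd Omega.

(** The constant sequence [phi] realises [phi] as its own trace. The boundary lies outside the open
    set [Omega], where [phi] vanishes, so this trace is zero on [GammaD]. *)
Lemma W1pD_test phi : test_fun Omega phi ->
  exists w : W1pD Omega p mu GammaD,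
    (w = phi :> ('rV[R]_d -> R)) /\ wgrad w = egrad phi.
Proof.
move=> tphi; have [sphi [K [cK KO phi0]]] := tphi.
have Lf := continuous_in_Lp oO bO p0 (smooth_continuous sphi).
have [_ cG] := smooth_C1 sphi.
have LG := continuous_in_Lpv oO bO p0 cG.
have wP psi i : test_fun Omega psi ->
    intO Omega (fun x => phi x * partial i psi x) =
    - intO Omega (fun x => egrad phi x ord0 i * psi x).
  move=> tpsi; rewrite test_fun_ibp//; congr (- _).
  by apply: eq_Rintegral => x _; rewrite mxE.
pose w := Build_W1p Lf LG wP.
have pn0 : p != 0 by rewrite gt_eqF// (lt_trans ltr01).
have zt : exists2 k, is_trace mu w k & {ae mu, forall x, GammaD x -> k x = 0}.
  exists phi; last first.
    apply: aeW => x /GammaD_bd[_ xO]; apply: phi0 => /KO Ox.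
    by apply: xO; exact: (open_nbhs_nbhs (conj oO Ox)).
  split; first by apply: continuous_measurable_rV; exact: smooth_continuous.
  have L0 (D : set 'rV[R]_d) (m : {measure set 'rV[R]_d -> \bar R}) (f : 'rV[R]_d -> R) :
      (forall x, f x = 0) -> (\int[m]_(x in D) (`|f x| `^ p)%:E = 0)%E.
    move=> f0; apply: integral0_eq => x _; by rewrite f0 normr0 powR0.
  exists (fun=> phi); split.
  - by move=> j; exact: smooth_C1.
  - apply: cvg_near_cst; apply: nearW => j; rewrite /W1pnorm /Lpow !L0 ?adde0.
    + by rewrite poweR0r// invr_eq0.
    + by move=> x; rewrite /= subrr enorm0.
    + by move=> x; rewrite /= subrr.
  - by apply: cvg_near_cst; apply: nearW => j; rewrite L0// => x; rewrite subrr.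
by exists (Build_W1pD zt).
Qed.

End sobolev_space.

(** * Growth of the stress *)

Section integrand.
Context {R : realType} {d : nat}.
Variables (Omega : set 'rV[R]_d) (p : R) (W : 'rV[R]_d -> R).
Hypotheses (oO : open Omega) (bO : bounded_set Omega) (p1 : 1 < p).
Hypotheses (W1 : C1 W) (cW : convex_fun W).
Local Notation q := (p / (p - 1)).
Implicit Types (G al be : 'rV[R]_d -> 'rV[R]_d).

Let mO : measurable Omega. Proof. exact: open_measurable_rV. Qed.
Let finO : (leb d Omega < +oo)%E. Proof. exact: bounded_leb_lty. Qed.
Let p0 : 0 <= p. Proof. by rewrite ltW// (lt_trans ltr01). Qed.
Let q0 : 0 <= q. Proof. by rewrite divr_ge0// subr_ge0 ltW. Qed.
Let dW x : differentiable W x. Proof. by have [] := W1. Qed.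

Lemma measurable_comp_C1 G : measurable_fun Omega G ->
  measurable_fun Omega (fun x => W (G x)).
Proof.
move=> mG; apply: (measurableT_comp _ mG); apply: continuous_measurable_rV => x.
exact: differentiable_continuous.
Qed.

Lemma measurable_comp_egrad G : measurable_fun Omega G ->
  measurable_fun Omega (fun x => egrad W (G x)).
Proof.
move=> mG; apply: (measurableT_comp _ mG).
by apply: continuous_measurable_rVv; have [] := W1.
Qed.

Lemma cst_in_Lpv r (c : 'rV[R]_d) : 0 <= r -> in_Lpv Omega r (fun=> c).
Proof.
move=> r0; exact: (continuous_in_Lpv oO bO r0 (@cst_continuous _ _ c)).
Qed.

Lemma integrable_cst_bounded (c : R) : (leb d).-integrable Omega (cst c%:E).
Proof.
apply/integrableP; split; first exact: measurable_cst.
by rewrite integral_cst//= lte_mul_pinfty.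
Qed.

(** Convexity encloses [W(G)] between [W(0) + DW(0).G] and [W(0) + DW(G).G], both integrable by
    Young's inequality. *)
Lemma integrable_convex_comp G : in_Lpv Omega p G ->
  in_Lpv Omega q (fun x => egrad W (G x)) ->
  (leb d).-integrable Omega (fun x => (W (G x))%:E).
Proof.
move=> LG LDG; have [mG _] := LG.
have i0 := integrable_dotvLp mO p1 LG (cst_in_Lpv (egrad W 0) q0).
have i1 := integrable_dotvLp mO p1 LG LDG.
have ic : (leb d).-integrable Omega (cst `|W 0|%:E).
  exact: integrable_cst_bounded.
have i2 := integrableD mO ic (integrableD mO (integrable_abse i0) (integrable_abse i1)).
apply: (le_integrable mO _ _ i2); first by apply/measurable_EFinP; exact: measurable_comp_C1.
move=> x _; rewrite /= lee_fin [leRHS]ger0_norm ?addr_ge0//.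
have := convex_grad_ineq (G x) (dW 0) cW; have := convex_grad_ineq 0 (dW (G x)) cW.
rewrite !dotvBr !dotv0r.
move: (dotv (egrad W 0) (G x)) (dotv (egrad W (G x)) (G x)) => a b.
have n (z : R) : - `|z| <= z <= `|z| by rewrite -ler_norml.
move: (n (W 0)) (n a) (n b) => /andP[? ?] /andP[? ?] /andP[? ?] ? ?.
by rewrite ler_norml; apply/andP; split; lra.
Qed.

Hypothesis p2 : 2 <= p.

Let pp : 0 < p. Proof. exact: lt_le_trans p2. Qed.
Let q_gt1 : 1 < q. Proof. exact: conj_exponent_gt1. Qed.
Let q_le2 : q <= 2. Proof.
by rewrite ler_pdivrMr ?subr_gt0// mulrBr mulr1 lerBrDr mulr_natl mulr2n lerD2l.
Qed.

Definition strong_convexity_bound (C0 : R) := forall al be,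
  in_Lpv Omega p al -> in_Lpv Omega p be ->
  (delta Omega p q W al be <= C0%:E * bregman Omega W al be (fun x => egrad W (al x)))%E.

Variable C0 : R.
Hypotheses (C00 : 0 < C0) (HC0 : strong_convexity_bound C0).

(* Absorption: if [X > 1] then [X <= X `^ (2 / q)] since [q <= 2], and half of
   [X] is absorbed on the left. *)
Lemma absorption (A X Y l : R) : 0 <= X -> 0 <= Y -> 0 < A -> 0 < l ->
  A * l `^ q = 2^-1 -> X `^ (2 / q) <= A * (l `^ q * X + l^-1 `^ p * Y) ->
  X <= 1 + 2 * A * l^-1 `^ p * Y.
Proof.
move=> X0 Y0 A0 l0 Al H.
have K0 : 0 <= A * l^-1 `^ p * Y by rewrite !mulr_ge0 ?powR_ge0// ltW.
have [X1|/ltW X1] := leP X 1; first by lra.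
have XX : X <= X `^ (2 / q).
  by apply: le1r_powR => //; rewrite ler_pdivlMr ?mul1r// (lt_trans ltr01).
have := le_trans XX H; rewrite mulrDr !mulrA Al; lra.
Qed.

(** Supplies the a priori finiteness that absorption requires: on bounded fields the continuous map
    [DW] is bounded. *)
Lemma bounded_egrad_bound be : measurable_fun Omega be ->
  (exists N, forall x, Omega x -> enorm (be x) <= N) ->
  in_Lpv Omega q (fun x => egrad W 0 - egrad W (be x)) /\ in_Lpv Omega p be.
Proof.
move=> mbe [N HN]; have [_ cD] := W1.
split; last exact: (in_Lpv_bounded mO p0 finO mbe HN).
have bA : bounded_set [set y : 'rV[R]_d | enorm y <= N].
  exists N; split=> [|c Nc y yN]; first exact: num_real.
  rewrite /= /Num.norm/= mx_normrE; apply/bigmax_leP; split => [|[i j] _ /=].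
    by apply/ltW/(le_lt_trans _ Nc)/(le_trans _ yN); exact: enorm_ge0.
  by rewrite (ord1 i); apply/ltW/(le_lt_trans _ Nc)/(le_trans _ yN); exact: coord_le_enorm.
have [B HB] := continuous_enorm_bounded cD bA.
apply: (@in_Lpv_bounded _ _ _ mO _ _ (enorm (egrad W 0) + B) q0 finO).
  under eq_fun do rewrite -scaleN1r.
  apply: measurable_rV_comb => //; exact: measurable_comp_egrad.
move=> x Ox; apply: (le_trans (ler_enormD _ _)); rewrite enormN lerD2l.
exact: HB (HN x Ox).
Qed.

(** The structural inequality is used between [0] and [be]. The bound [B] comes before [be] and
    ignores its supremum [N], which is what allows the truncation level to tend to infinity. *)
Lemma egrad_growth_bounded (Y : R) : exists B, forall be,
  measurable_fun Omega be ->
  (exists N, forall x, Omega x -> enorm (be x) <= N) ->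
  (Lpow Omega p (enorm \o be) <= Y%:E)%E ->
  (Lpow Omega q (fun x => enorm (egrad W 0 - egrad W (be x))) <= B%:E)%E.
Proof.
(* [A] is the factor in front of the Bregman bound once the denominator of [delta] is cleared; [l]
   is chosen so that [A * l ^ q = 1/2]. *)
pose A := C0 * (1 + Y) `^ ((2 - q) / q); pose l := (2 * A)^-1 `^ (q^-1).
exists (1 + 2 * A * l^-1 `^ p * Y) => be mbe bbe beY.
have [LD Lbe] := bounded_egrad_bound mbe bbe.
have Y0 : 0 <= Y by rewrite -lee_fin (le_trans _ beY)// Lpow_ge0.
have A0 : 0 < A by rewrite mulr_gt0// powR_gt0//; lra.
have l0 : 0 < l by rewrite powR_gt0// invr_gt0 mulr_gt0.
have q_gt0 : 0 < q by rewrite (lt_trans ltr01).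
have Al : A * l `^ q = 2^-1.
  have An0 : A != 0 by rewrite gt_eqF.
  rewrite /l -powRrM mulVf ?gt_eqF// powRr1; last by rewrite invr_ge0 mulr_ge0// ltW.
  by rewrite invfM mulrCA mulfV ?mulr1.
set XE := Lpow Omega q _.
have XEfin : (XE < +oo)%E by have [] := LD.
have XE0 : (0 <= XE)%E by exact: Lpow_ge0.
pose X := fine XE; have XX : XE = X%:E by rewrite fineK// ge0_fin_numE.
have X0 : 0 <= X by rewrite fine_ge0.
rewrite XX lee_fin; apply: (absorption X0 Y0 A0 l0 Al).
have := HC0 (cst_in_Lpv 0 p0) Lbe; rewrite /delta /Lpnorm.
rewrite -/XE XX poweR_EFin.
have -> : Lpow Omega p (enorm \o (fun=> 0 : 'rV[R]_d)) = 0%E.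
  by apply: integral0_eq => x _; rewrite /= enorm0 normr0 powR0// gt_eqF.
pose Z := fine (Lpow Omega p (enorm \o be)).
have ZE : Lpow Omega p (enorm \o be) = Z%:E.
  have [_ Lfin] := Lbe.
  by apply/esym/fineK; rewrite (ge0_fin_numE (Lpow_ge0 _ _ _)); exact: Lfin.
have Z0 : 0 <= Z by apply: fine_ge0; exact: Lpow_ge0.
have ZY : Z <= Y by rewrite -lee_fin -ZE.
rewrite ZE adde0 -EFinD poweR_EFin inver.
have K0 : 0 < (1 + Z) `^ ((2 - q) / q) by rewrite powR_gt0//; lra.
rewrite (gt_eqF K0) -EFin_expe -EFinM.
have -> : X `^ q^-1 ^+ 2 = X `^ (2 / q).
  by rewrite -powR_mulrn ?powR_ge0// -powRrM [_ * 2]mulrC.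
move=> H.
have : ((X `^ (2 / q) / (1 + Z) `^ ((2 - q) / q))%:E <=
    (C0 * (l `^ q * X + l^-1 `^ p * Z))%:E)%E.
  apply: (le_trans H); rewrite EFinM lee_pmul2l ?fin_numE ?lte_fin//.
  apply: (@le_trans _ _ (\int[leb d]_(x in Omega)
    ((l `^ q)%:E * (`|enorm (egrad W 0 - egrad W (be x))%R| `^ q)%:E +
     (l^-1 `^ p)%:E * (`|(enorm \o be) x| `^ p)%:E))%E).
    apply: le_integral_pointwise => x Ox; rewrite -!EFinM -EFinD lee_fin subr0.
    (* Convexity at [be x], tested at [0], bounds the Bregman integrand by
       [(DW(be x) - DW(0)) . be x], to which Cauchy-Schwarz and the scaled Young inequality
       apply. *)
    have := convex_grad_ineq 0 (dW (be x)) cW; rewrite dotvBr dotv0r => h1.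
    have := dotv_le_enorm (egrad W 0 - egrad W (be x)) (be x).
    rewrite dotvBl ler_norml => /andP[h2 _].
    have := young_powR_scaled (enorm_ge0 (be x))
      (enorm_ge0 (egrad W 0 - egrad W (be x))) p1 l0.
    rewrite /= !(ger0_norm (enorm_ge0 _)) [enorm (be x) * _]mulrC => h3.
    lra.
  have mg r g : in_Lp Omega r g -> measurable_fun Omega (fun x => (`|g x| `^ r)%:E).
    by move=> /integrable_Lpow /integrableP[].
  have [LD' Lbe'] := (in_Lp_enorm LD, in_Lp_enorm Lbe).
  rewrite ge0_integralD//; [|by move=> x _; rewrite -EFinM lee_fin mulr_ge0 ?powR_ge0
    |by apply: emeasurable_funM => //; exact: (mg _ _ LD')
    |by move=> x _; rewrite -EFinM lee_fin mulr_ge0 ?powR_ge0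
    |by apply: emeasurable_funM => //; exact: (mg _ _ Lbe')].
  rewrite !ge0_integralZl ?lee_fin ?powR_ge0//;
    try (by move=> x _; rewrite lee_fin powR_ge0); [|exact: (mg _ _ Lbe')|exact: (mg _ _ LD')].
  rewrite -[X in ((l `^ q)%:E * X)%E]/XE.
  rewrite -[X in ((l^-1 `^ p)%:E * X)%E]/(Lpow Omega p (enorm \o be)).
  by rewrite XX ZE -!EFinM -EFinD.
rewrite lee_fin ler_pdivrMr// => h; apply: (le_trans h).
(* Since [q <= 2] the exponent is nonnegative, so the denominator of [delta] increases with [Z] and
   [Z] may be replaced by its bound [Y]. *)
have e0 : 0 <= (2 - q) / q by rewrite divr_ge0// subr_ge0.
rewrite mulrAC /A; apply: ler_pM.
- by rewrite mulr_ge0 ?powR_ge0// ltW.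
- exact: (addr_ge0 (mulr_ge0 (powR_ge0 _ _) X0) (mulr_ge0 (powR_ge0 _ _) Z0)).
- rewrite ler_pM2l//; apply: ge0_ler_powR; rewrite ?nnegrE//; lra.
- by rewrite lerD2l; exact: (ler_wpM2l (powR_ge0 _ _) ZY).
Qed.

(* Bound the truncations of [be] and let the truncation level go to infinity. *)
Lemma egrad_in_Lpv be : in_Lpv Omega p be ->
  in_Lpv Omega q (fun x => egrad W (be x)).
Proof.
move=> Lbe; have [mbe beoo] := Lbe.
have beE : Lpow Omega p (enorm \o be) = (fine (Lpow Omega p (enorm \o be)))%:E.
  by apply/esym/fineK; rewrite (ge0_fin_numE (Lpow_ge0 _ _ _)); exact: beoo.
have [B HB] := egrad_growth_bounded (fine (Lpow Omega p (enorm \o be))).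
pose g x := (`|enorm (egrad W 0 - egrad W (be x))| `^ q)%:E.
pose F (N : nat) := Omega `&` [set x | enorm (be x) <= N%:R].
have mF N : measurable (F N).
  have := measurable_enorm mbe mO (measurable_itv `]-oo, N%:R]).
  by congr measurable; apply/seteqP; split => x [? h]; split => //; move: h; rewrite /= in_itv.
have mD : measurable_fun Omega (fun x => egrad W 0 - egrad W (be x)).
  under eq_fun do rewrite -scaleN1r.
  by apply: measurable_rV_comb => //; exact: measurable_comp_egrad.
have mg : measurable_fun Omega g.
  apply/measurable_EFinP.
  apply: (measurable_powR_norm q (g := fun x => enorm (egrad W 0 - egrad W (be x)))).
  exact: measurable_enorm.
have FB N : (\int[leb d]_(x in F N) g x <= B%:E)%E.
  pose bN x := if x \in F N then be x else 0.
  have mbN : measurable_fun Omega bN.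
    apply: (measurable_funS measurableT) => //; apply: measurable_extend0_rV => // i.
    by apply: measurable_fun_coord; apply: measurable_funS mbe => // x [].
  have bNle x : enorm (bN x) <= enorm (be x).
    by rewrite /bN; case: ifP => // _; rewrite enorm0 enorm_ge0.
  have bNN : exists c, forall x, Omega x -> enorm (bN x) <= c.
    exists N%:R => x _; rewrite /bN; case: ifPn => [/set_mem[]//|_].
    by rewrite enorm0.
  have bNp : (Lpow Omega p (enorm \o bN) <= (fine (Lpow Omega p (enorm \o be)))%:E)%E.
    rewrite -beE; apply: le_integral_pointwise => x _; rewrite lee_fin.
    by apply: ge0_ler_powR; rewrite ?nnegrE//= !ger0_norm ?enorm_ge0.
  apply: le_trans (HB bN mbN bNN bNp); rewrite /F integral_mkcondr.
  apply: le_integral_pointwise => x Ox; rewrite patchE; case: ifPn => [/set_mem/= xN|_].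
    by rewrite /bN mem_set//; split.
  by rewrite lee_fin powR_ge0.
have cvF : (\int[leb d]_(x in F N) g x)%E @[N --> \oo] -->
    (\int[leb d]_(x in \bigcup_N F N) g x)%E.
  apply: ge0_nondecreasing_set_cvg_integral => //.
  - apply/nondecreasing_seqP => N; rewrite subsetEset => x [Ox xN]; split => //=.
    by apply: (le_trans xN); rewrite ler_nat.
  - by move=> N; apply: measurable_funS mg => // x [].
  - by move=> N x _; rewrite lee_fin powR_ge0.
have UF : \bigcup_N F N = Omega.
  apply/seteqP; split => [x [N _ []]//|x Ox].
  exists (Num.truncn (enorm (be x))).+1 => //; split => //=.
  by apply: ltW; exact: truncnS_gt.
rewrite UF in cvF.
have LG : in_Lpv Omega q (fun x => egrad W 0 - egrad W (be x)).
  split; first exact: mD.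
  have gB : (\int[leb d]_(x in Omega) g x <= B%:E)%E.
    by apply: (cvge_to_le cvF); exact: nearW.
  exact: (le_lt_trans gB (ltry _)).
have := in_Lpv_comb mO (-1) q0 (cst_in_Lpv (egrad W 0) q0) LG.
by under eq_fun do rewrite scaleN1r opprB addrC subrK.
Qed.

End integrand.

(** * Duality *)

Lemma affine_continuous (R : realType) (a b : R) : continuous (fun t : R => a + t * b).
Proof.
move=> t; apply: (@continuousD R R^o R (cst a) (fun t => t * b)).
  exact: cst_continuous.
apply: (@continuousM R R^o id (cst b)); [exact: cvg_id|exact: cst_continuous].
Qed.

Section duality.
Context {R : realType} {d : nat}.
Variables (Omega : set 'rV[R]_d) (p : R) (W f : 'rV[R]_d -> R).
Variables (mu : {measure set 'rV[R]_d -> \bar R}) (GammaD : set 'rV[R]_d).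
Hypotheses (oO : open Omega) (bO : bounded_set Omega) (p1 : 1 < p).
Hypotheses (W1 : C1 W) (cW : convex_fun W).
Local Notation q := (p / (p - 1)).
Local Notation V := (W1pD Omega p mu GammaD).
Local Notation Sigma := (WdivN Omega p q mu GammaD).
Hypothesis Lf : in_Lp Omega q f.

Let mO : measurable Omega. Proof. exact: open_measurable_rV. Qed.
Let p0 : 0 <= p. Proof. by rewrite ltW// (lt_trans ltr01). Qed.
Let q0 : 0 <= q. Proof. by rewrite divr_ge0// subr_ge0 ltW. Qed.
Let dW x : differentiable W x. Proof. by have [] := W1. Qed.

Local Notation integrableO g := ((leb d).-integrable Omega (fun x => (g x)%:E)).

Lemma intO_EFin (g : 'rV[R]_d -> R) : integrableO g ->
  (\int[leb d]_(x in Omega) (g x)%:E)%E = (intO Omega g)%:E.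
Proof. by move=> ig; apply/esym/fineK; exact: integrable_fin_num. Qed.

Lemma integrable_load (v : V) : integrableO (fun x => f x * v x).
Proof.
have := integrable_mulLp mO p1 (wfun_Lp v) Lf.
by under eq_fun do rewrite mulrC.
Qed.

Lemma integrable_flux (tau : Sigma) (v : V) :
  integrableO (fun x => dotv (tau x) (wgrad v x)).
Proof. exact: (integrable_dotvLp mO p1 (wgrad_Lp v) (tfun_Lp tau)). Qed.

Lemma energyE (v : V) : integrableO (fun x => W (wgrad v x)) ->
  energy W f v = (intO Omega (fun x => W (wgrad v x)) -
                  intO Omega (fun x => f x * v x))%:E.
Proof.
move=> iW; have iL := integrable_load v.
rewrite /energy intO_EFin.
  by congr (_%:E); rewrite /intO RintegralB.
by under eq_fun do rewrite EFinB; exact: integrableB.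
Qed.

(** A measurable function with finite integral is integrable, and the load term, integrable by
    itself, can be added back. This provides integrability of [W(grad v)] without any growth of
    [DW]. *)
Lemma energy_fin_integrable (v : V) : energy W f v \is a fin_num ->
  integrableO (fun x => W (wgrad v x)).
Proof.
move=> Efin; have [mG _] := wgrad_Lp v; have iL := integrable_load v.
have mL : measurable_fun Omega (fun x => f x * v x).
  by have /integrableP[/measurable_EFinP] := iL.
have mE : measurable_fun Omega (fun x => W (wgrad v x) - f x * v x).
  by apply: measurable_funB => //; exact: measurable_comp_C1.
have iE : integrableO (fun x => W (wgrad v x) - f x * v x).
  apply/integrableP; split; first exact/measurable_EFinP.
  by rewrite integral_fin_num_abs.
have := integrableD mO iE iL.
by under eq_fun do rewrite -EFinD subrK.
Qed.

Lemma normal_traceE (tau : Sigma) (v : V) :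
  {ae leb d, forall x, Omega x -> wdiv tau x = - f x} ->
  intO Omega (fun x => dotv (tau x) (wgrad v x)) = intO Omega (fun x => f x * v x).
Proof.
move=> div; have := zero_normal_trace tau v.
have idv : integrableO (fun x => wdiv tau x * v x).
  have := integrable_mulLp mO p1 (wfun_Lp v) (wdiv_Lp tau).
  by under eq_fun do rewrite mulrC.
rewrite /intO RintegralD//; last exact: integrable_flux.
have -> : \int[leb d]_(x in Omega) (wdiv tau x * v x) =
    - 1 * \int[leb d]_(x in Omega) (f x * v x).
  have iL := integrable_load v.
  rewrite -RintegralZl//; congr fine; apply: ae_eq_integral => //.
  - by have /integrableP[] := idv.
  - apply/measurable_EFinP; apply: measurable_funM => //.
    by have /integrableP[/measurable_EFinP] := iL.
  - by apply: filterS div => x h Ox; rewrite h// mulNr mulN1r.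
by rewrite mulN1r => /subr0_eq.
Qed.

Lemma weak_duality (u : V) (tau : Sigma) : energy W f u \is a fin_num ->
  (dual_energy W f tau <= energy W f u)%E.
Proof.
move=> Efin; rewrite /dual_energy; case: asboolP => [div|_]; last exact: leNye.
have iW := energy_fin_integrable Efin; have it := integrable_flux tau u.
rewrite energyE// leeNl -EFinN opprB -(normal_traceE u div).
rewrite /intO -RintegralB// -intO_EFin; last first.
  by under eq_fun do rewrite EFinB; exact: integrableB.
(* No integrability of the conjugate along [tau] is known here, hence the unconditional monotonicity
   of the integral. *)
by apply: le_integral_pointwise => x Ox; exact: fenchel_ineq.
Qed.

(** The form in which the structural inequality enters the duality argument; [egrad_in_Lpv] provides
    it. *)
Hypothesis HD : forall be : 'rV[R]_d -> 'rV[R]_d, in_Lpv Omega p be ->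
  in_Lpv Omega q (fun x => egrad W (be x)).

Lemma integrable_stored (v : V) : integrableO (fun x => W (wgrad v x)).
Proof.
by apply: (integrable_convex_comp oO bO p1 W1 cW); [exact: wgrad_Lp|
  apply: HD; exact: wgrad_Lp].
Qed.

(** * The Euler-Lagrange equation of the minimiser *)

Section euler_lagrange.
Variables (u v : V).
Hypothesis umin : forall w : V, (energy W f u <= energy W f w)%E.

Let slope (t : R) x := dotv (egrad W (wgrad u x + t *: wgrad v x)) (wgrad v x).

Let LDt t : in_Lpv Omega q (fun x => egrad W (wgrad u x + t *: wgrad v x)).
Proof. by apply: HD; apply: in_Lpv_comb => //; exact: wgrad_Lp. Qed.

Let islope t : integrableO (slope t).
Proof. exact: (integrable_dotvLp mO p1 (wgrad_Lp v) (LDt t)). Qed.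

(** The energy is not differentiated. Minimality of [u] against [u + t v], with convexity at the
    perturbed point, fixes the sign of the difference of slope and load for every [t] of either
    sign. *)
Let slope_ge (t : R) :
  0 <= t * (intO Omega (slope t) - intO Omega (fun x => f x * v x)).
Proof.
have [w [wE GwE]] := W1pD_comb oO bO p1 u v t.
have := umin w; rewrite !energyE; try exact: integrable_stored.
have -> : intO Omega (fun x => f x * w x) =
    intO Omega (fun x => f x * u x) + t * intO Omega (fun x => f x * v x).
  rewrite -(intO_comb oO t (integrable_load u) (integrable_load v)).
  by apply: eq_Rintegral => x _; rewrite wE; ring.
have : intO Omega (fun x => W (wgrad w x)) <=
    intO Omega (fun x => W (wgrad u x)) + t * intO Omega (slope t).
  rewrite -(intO_comb oO t (integrable_stored u) (islope t)).
  apply: le_Rintegral => //; first exact: integrable_stored.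
    apply: (eq_integrable mO) (integrableD mO (integrable_stored u)
      (integrableZl mO t (islope t))).
    by move=> x _; rewrite /= EFinD EFinM.
  move=> x Ox; have := convex_grad_ineq (wgrad u x) (dW (wgrad w x)) cW.
  rewrite GwE opprD addrA subrr add0r -scaleNr dotvZr -/(slope t x); lra.
rewrite lee_fin; lra.
Qed.

(** Adding the two gradient inequalities gives monotonicity. It confines the slopes for [|t| <= 1]
    between those at [-1] and [1], which produces the dominating function. *)
Let slope_mono x : {homo (fun t => slope t x) : s t / s <= t}.
Proof.
move=> s t; rewrite le_eqVlt => /predU1P[->//|st].
set y := wgrad u x + s *: wgrad v x; set z := wgrad u x + t *: wgrad v x.
have := convex_grad_ineq z (dW y) cW; have := convex_grad_ineq y (dW z) cW.
have zy : z - y = (t - s) *: wgrad v x.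
  by rewrite /z /y; apply/rowP => i; rewrite !mxE; ring.
have yz : y - z = (s - t) *: wgrad v x.
  by rewrite /z /y; apply/rowP => i; rewrite !mxE; ring.
rewrite zy yz !dotvZr -[dotv (egrad W z) _]/(slope t x) -[dotv (egrad W y) _]/(slope s x).
move=> h1 h2; rewrite -subr_ge0 -(pmulr_rge0 _ (_ : 0 < t - s)) ?subr_gt0//; lra.
Qed.

Let slope_continuous x : continuous (slope ^~ x).
Proof.
have cl : continuous (fun t : R => wgrad u x + t *: wgrad v x).
  apply: continuous_rV => i; rewrite (_ : (fun t => _) =
    (fun t : R => wgrad u x ord0 i + t * wgrad v x ord0 i)).
    exact: affine_continuous.
  by apply/funext => t; rewrite !mxE.
apply: continuous_sum => i t; apply: continuousM; last exact: cst_continuous.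
apply: (continuous_comp (f := fun t : R => egrad W (wgrad u x + t *: wgrad v x))
  (g := fun y : 'rV[R]_d => y ord0 i)); last exact: coord_continuous.
by apply: (continuous_comp (cl t)); have [_] := W1; exact.
Qed.

Let slope_cvg (e : R) : `|e| <= 1 ->
  (fun j : nat => intO Omega (slope (e * j.+1%:R^-1))) @ \oo --> intO Omega (slope 0).
Proof.
move=> e1.
have sj j : `|e * j.+1%:R^-1| <= 1.
  rewrite normrM mulr_ile1//ger0_norm// invf_le1//.
  by rewrite ler1n.
have cs : (fun j : nat => e * j.+1%:R^-1) @ \oo --> (0 : R).
  rewrite -[X in _ --> X](mulr0 e); apply: cvgMr.
  exact: cvg_harmonic.
have ms t : measurable_fun Omega (fun x => (slope t x)%:E).
  by have /integrableP[] := islope t.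
have ib := integrableD mO (integrable_abse (islope (-1))) (integrable_abse (islope 1)).
have [||||_ _] := @dominated_convergence _ _ _ (leb d) Omega mO
  (fun j x => (slope (e * j.+1%:R^-1) x)%:E) (fun x => (slope 0 x)%:E) _ _ _ _ ib.
- by move=> j; exact: ms.
- exact: ms.
- apply: aeW => x Ox; apply: cvg_EFin; first exact: nearW.
  exact: (continuous_cvg _ (slope_continuous (x := x) (x0 := 0)) cs).
- apply: aeW => x j Ox; rewrite /= lee_fin.
  have := sj j; rewrite ler_norml => /andP[s1 s2].
  have := slope_mono x s1; have := slope_mono x s2 => h2 h1.
  have := ler_norm (slope 1 x); have := ler_norm (- slope (-1) x); rewrite normrN.
  have := normr_ge0 (slope 1 x); have := normr_ge0 (slope (-1) x).
  by move=> n1 n2 h3 h4; rewrite ler_norml; apply/andP; split; lra.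
rewrite (intO_EFin (islope 0)) => /fine_cvg; exact.
Qed.

Lemma euler_lagrange : intO Omega (fun x => dotv (egrad W (wgrad u x)) (wgrad v x)) =
  intO Omega (fun x => f x * v x).
Proof.
have s0 x : dotv (egrad W (wgrad u x)) (wgrad v x) = slope 0 x.
  by rewrite /slope scale0r addr0.
rewrite (_ : (fun x => _) = slope 0); last by apply/funext => x; exact: s0.
have n1 : `|1 : R| <= 1 by rewrite normr1.
have nN1 : `|-1 : R| <= 1 by rewrite normrN1.
have jp j : 0 < j.+1%:R^-1 :> R by rewrite invr_gt0.
apply/le_anti/andP; split.
  (* Negative steps bound the limit slope above by the load, positive steps bound it below. *)
  apply: (cvgr_to_le (slope_cvg nN1)); apply: nearW => j.
  have := slope_ge (-1 * j.+1%:R^-1).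
  by rewrite {1}mulN1r nmulr_rge0 ?oppr_lt0// subr_le0.
apply: (cvgr_to_ge (slope_cvg n1)); apply: nearW => j.
by have := slope_ge (1 * j.+1%:R^-1); rewrite {1}mul1r pmulr_rge0// subr_ge0.
Qed.

End euler_lagrange.

(** * Optimality relations between [u] and [sigma] *)

Section primal_dual.
Variables (u : V) (sigma : Sigma).
Hypothesis umin : forall w : V, (energy W f u <= energy W f w)%E.
Hypothesis sigmamax : forall tau : Sigma,
  (dual_energy W f tau <= dual_energy W f sigma)%E.
Hypothesis GammaD_bd : GammaD `<=` bd Omega.

Let LDu : in_Lpv Omega q (fun x => egrad W (wgrad u x)).
Proof. by apply: HD; exact: wgrad_Lp. Qed.

Let Lnf : in_Lp Omega q (fun x => - f x).
Proof.
have [mf _] := Lf; apply: (in_Lp_le q0 _ Lf); first exact: measurableT_comp.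
by move=> x _; rewrite normrN.
Qed.

Lemma energy_fin (v : V) : energy W f v \is a fin_num.
Proof. by rewrite energyE//; exact: integrable_stored. Qed.

(** One equation plays two roles: tested with [V] it is the vanishing normal trace of [DW(grad u)],
    tested with test functions it says that the weak divergence is [-f]. The equality of energies is
    the Fenchel equality at [DW(grad u)], integrated. *)
Lemma stress_dual_energy : exists tau : Sigma, dual_energy W f tau = energy W f u.
Proof.
have EL v := euler_lagrange v umin.
have ntr (v : V) : intO Omega (fun x => dotv (egrad W (wgrad u x)) (wgrad v x) +
    - f x * v x) = 0.
  have iD := integrable_dotvLp mO p1 (wgrad_Lp v) LDu.
  transitivity (intO Omega (fun x => dotv (egrad W (wgrad u x)) (wgrad v x)) +
      - 1 * intO Omega (fun x => f x * v x)).
    rewrite -(intO_comb oO _ iD (integrable_load v)).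
    by apply: eq_Rintegral => x _; rewrite mulN1r mulNr.
  by rewrite EL mulN1r subrr.
have divP phi : test_fun Omega phi ->
    intO Omega (fun x => dotv (egrad W (wgrad u x)) (egrad phi x)) =
    - intO Omega (fun x => - f x * phi x).
  move=> tphi; have [w [wE GwE]] := W1pD_test oO bO p1 mu GammaD_bd tphi.
  have := EL w; rewrite wE GwE => ->.
  have iL := integrable_load w; rewrite wE in iL.
  rewrite [in RHS](_ : (fun x => - f x * phi x) = (fun x => -1 * (f x * phi x))).
    by rewrite /intO RintegralZl// mulN1r opprK.
  by apply/funext => x; rewrite mulN1r mulNr.
exists (Build_WdivN LDu Lnf divP ntr).
rewrite /dual_energy asboolT/=; last exact: aeW.
have iD := integrable_dotvLp mO p1 (wgrad_Lp u) LDu.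
under eq_integral do rewrite convex_conj_egrad//.
rewrite energyE; last exact: integrable_stored.
rewrite intO_EFin; last first.
  by under eq_fun do rewrite EFinB; apply: integrableB => //; exact: integrable_stored.
rewrite /intO RintegralB//; last exact: integrable_stored.
by rewrite -[X in X - _]/(intO _ _) EL -EFinN opprB.
Qed.

Lemma strong_duality : dual_energy W f sigma = energy W f u.
Proof.
apply/le_anti; rewrite weak_duality ?energy_fin//=.
by have [tau <-] := stress_dual_energy; exact: sigmamax.
Qed.

(** Otherwise [dual_energy] would be [-oo] at [sigma], whereas it equals the finite energy of
    [u]. *)
Lemma dual_maximizer_div : {ae leb d, forall x, Omega x -> wdiv sigma x = - f x}.
Proof.
have := strong_duality; rewrite /dual_energy; case: asboolP => // _ EN.
by have := energy_fin u; rewrite -EN.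
Qed.

(* The duality gap is the integral of the pointwise Fenchel-Young gap. *)
Lemma dual_maximizerE :
  {ae leb d, forall x, Omega x -> sigma x = egrad W (wgrad u x)}.
Proof.
have div := dual_maximizer_div.
pose h x := dotv (sigma x) (wgrad u x) - W (wgrad u x).
have ist := integrable_flux sigma u; have iW := integrable_stored u.
have ih : integrableO h by rewrite /h; under eq_fun do rewrite EFinB; exact: integrableB.
have hE : (\int[leb d]_(x in Omega) (h x)%:E)%E = (- energy W f u)%E.
  rewrite intO_EFin// energyE// -EFinN opprB -(normal_traceE u div).
  by congr (_%:E); rewrite /intO RintegralB.
have cE : (\int[leb d]_(x in Omega) convex_conj W (sigma x) = - energy W f u)%E.
  have := strong_duality; rewrite /dual_energy asboolT// => <-.
  by rewrite oppeK.
have mc : measurable_fun Omega (fun x => convex_conj W (sigma x)).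
  by apply: (measurableT_comp (measurable_convex_conj W)); have [] := tfun_Lp sigma.
have ic : (leb d).-integrable Omega (fun x => convex_conj W (sigma x)).
  apply/integrableP; split => //; apply/abse_integralP => //.
  by rewrite cE abseN -fin_num_abs energy_fin.
have gap0 x : (0 <= convex_conj W (sigma x) - (h x)%:E)%E.
  by rewrite sube_ge0 ?fin_numE//; exact: fenchel_ineq.
have : (\int[leb d]_(x in Omega) `|convex_conj W (sigma x) - (h x)%:E| = 0)%E.
  under eq_integral do rewrite gee0_abs//.
  rewrite (integralB mO ic ih) cE hE subee// fin_numN; exact: energy_fin.
move/(ae_eq_integral_abs _ mO) => [|N [mN N0 sN]].
  apply: emeasurable_funB => //; have /integrableP[mh _] := ih; exact: mh.
exists N; split => //; apply: subset_trans sN => x /= nx H; apply: nx => Ox.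
(* A zero gap excludes infinite values of the conjugate; what remains is equality in the Fenchel
   inequality. *)
have := H Ox; case E : (convex_conj W (sigma x)) => [r| |]//= [/subr0_eq rE].
by apply: fenchel_eq => //; rewrite E rE.
Qed.

Lemma bregman_dual_maximizer (v : V) :
  bregman Omega W (wgrad u) (wgrad v) sigma = (energy W f v - energy W f u)%E.
Proof.
have div := dual_maximizer_div.
have iu := integrable_stored u; have iv := integrable_stored v.
have su := integrable_flux sigma u; have sv := integrable_flux sigma v.
rewrite !energyE// -!(normal_traceE _ div) -EFinB.
transitivity (\int[leb d]_(x in Omega) ((W (wgrad v x) - dotv (sigma x) (wgrad v x)) -
   (W (wgrad u x) - dotv (sigma x) (wgrad u x)))%:E)%E.
  by apply: eq_integral => x _; rewrite dotvBr; congr (_%:E); ring.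
have i1 (w : V) : integrableO (fun x => W (wgrad w x) - dotv (sigma x) (wgrad w x)).
  under eq_fun do rewrite EFinB; apply: integrableB => //; first exact: integrable_stored.
  exact: integrable_flux.
rewrite intO_EFin; last by under eq_fun do rewrite EFinB; apply: integrableB => //; exact: i1.
rewrite /intO RintegralB//; [|exact: i1|exact: i1].
by rewrite !RintegralB.
Qed.

(** The structural inequality speaks of [DW(grad u)], the final estimate of the representative
    [sigma]; they agree almost everywhere. *)
Lemma bregman_egrad (v : V) :
  bregman Omega W (wgrad u) (wgrad v) (fun x => egrad W (wgrad u x)) =
  bregman Omega W (wgrad u) (wgrad v) sigma.
Proof.
have [mu' _] := wgrad_Lp u; have [mv _] := wgrad_Lp v; have [ms _] := tfun_Lp sigma.
have mB (s : 'rV[R]_d -> 'rV[R]_d) : measurable_fun Omega s -> measurable_fun Omega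
    (fun x => (W (wgrad v x) - W (wgrad u x) - dotv (s x) (wgrad v x - wgrad u x))%:E).
  move=> msx; apply/measurable_EFinP; apply: measurable_funB.
    by apply: measurable_funB; exact: measurable_comp_C1.
  apply: measurable_dotv => //; under eq_fun do rewrite -scaleN1r.
  exact: measurable_rV_comb.
apply: ae_eq_integral => //.
- by apply: mB; exact: measurable_comp_egrad.
- exact: mB.
by apply: filterS dual_maximizerE => x sx Ox; rewrite sx.
Qed.

End primal_dual.
End duality.

(** * The a posteriori error bounds *)

Theorem mainTheorem7 (R : realType) (n : nat)
  (Omega GammaD : set 'rV[R]_n.+1) (T0 : mesh R n.+1)
  (p p' : R) (W : 'rV[R]_n.+1 -> R)
  (mu : {measure set 'rV[R]_n.+1 -> \bar R} := surface_measure T0 Omega) :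
  (* the polyhedral Lipschitz domain; T0 witnesses that it is polyhedral and
     computes its surface measure mu *)
  lipschitz_domain Omega -> triangulation T0 Omega ->
  compact GammaD -> GammaD `<=` bd Omega -> (0 < mu GammaD)%E ->
  1 < p -> p' = p / (p - 1) ->
  C1 W -> convex_fun W ->
  exists C : R, 0 < C /\
  forall (M : mesh R n.+1) (nu : {set 'I_(nvert M)} -> 'rV[R]_n.+1)
    (k : nat) (r s : R) (fM : {set 'I_(nvert M)} -> 'rV[R]_n.+1 -> R)
    (f := pw_glue fM)
    (u vC : W1pD Omega p mu GammaD)
    (sigma sigmaRT : WdivN Omega p p' mu GammaD)
    (uh : {set 'I_(nvert M)} -> 'rV[R]_n.+1 -> R),
  triangulation M Omega -> normals nu ->
  (1 <= k)%N -> 1 < r -> Pk k fM ->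
  assumption_A1 Omega p mu GammaD W f ->
  assumption_A2 Omega p mu GammaD W f ->
  (forall v : W1pD Omega p mu GammaD, (energy W f u <= energy W f v)%E) ->
  (forall tau : WdivN Omega p p' mu GammaD,
     (dual_energy W f tau <= dual_energy W f sigma)%E) ->
  Pk k uh ->
  (forall vh, Pk k vh ->
     discrete_energy Omega GammaD nu W (projM k fM) k r s uh <=
     discrete_energy Omega GammaD nu W (projM k fM) k r s vh) ->
  RT_reconstruction Omega GammaD nu W k r s uh sigmaRT ->
  let eta := (energy W f vC - dual_energy W f sigmaRT)%E in
  (energy W f vC - energy W f u <= eta)%E /\
  (2 <= p ->
   (exists C0 : R, 0 < C0 /\
      forall al be, in_Lpv Omega p al -> in_Lpv Omega p be ->
        (delta Omega p p' W al be <=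
         C0%:E * bregman Omega W al be (egrad W \o al))%E) ->
   [/\ (delta Omega p p' W (wgrad u) (wgrad vC) <=
        C%:E * bregman Omega W (wgrad u) (wgrad vC) sigma)%E,
       bregman Omega W (wgrad u) (wgrad vC) sigma =
         (energy W f vC - energy W f u)%E &
       (energy W f vC - energy W f u <= eta)%E]).
Proof.
move=> [oO _ _ bO _] _ _ GammaD_bd _ p1 -> W1 cW.
set q := p / (p - 1).
(* The constant is fixed before the mesh, the load and the structural hypothesis are introduced. A
   classical case distinction picks a valid constant if there is one; otherwise the implication to
   be shown is vacuous and [1] serves. *)
have [C [C0 HC]] : exists C : R, 0 < C /\ ((exists C0 : R, 0 < C0 /\
    strong_convexity_bound Omega p W C0) -> strong_convexity_bound Omega p W C).
  have [[C [C0 HC]]|nC] := pselect (exists C0 : R, 0 < C0 /\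
    strong_convexity_bound Omega p W C0); first by exists C.
  by exists 1; split => // /nC.
exists C; split=> // M nu k r s fM f u vC sigma sigmaRT uh tM _ _ _ fMk A1 A2 umin
  smax _ _ _ eta.
have mO : measurable Omega by exact: open_measurable_rV.
have finO : (leb n.+1 Omega < +oo)%E by exact: bounded_leb_lty.
(* A piecewise polynomial is bounded on the bounded set [Omega], hence in every [L^q] there. *)
have Lf : in_Lp Omega q f.
  have [B HB] := pw_glue_bounded fMk bO.
  apply: (in_Lp_bounded mO _ finO _ HB).
    by rewrite divr_ge0 ?subr_ge0 ?ltW// (lt_trans ltr01).
  by apply: (measurable_funS measurableT) => //; exact: measurable_pw_glue fMk.
(* (A1) bounds the infimum away from [-oo], and minimality bounds [E(u)] by the finite value at
   [v0]. *)
have Eu : energy W f u \is a fin_num.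
  have [infE [v0 [Ev0 _]]] := A1; rewrite fin_numE.
  rewrite gt_eqF; last by apply: (lt_le_trans infE); apply: ereal_inf_lbound; exists u.
  by rewrite lt_eqF// (le_lt_trans (umin v0)).
have weak : (energy W f vC - energy W f u <= eta)%E.
  by rewrite /eta leeD2l// leeN2; exact: weak_duality.
split=> // p2 Hex.
have HCW := HC Hex.
have HD := egrad_in_Lpv oO bO p1 W1 cW p2 C0 HCW.
split=> //; last exact: (bregman_dual_maximizer oO bO p1 W1 cW Lf HD umin smax).
rewrite -(bregman_egrad oO bO p1 W1 cW Lf HD umin smax GammaD_bd).
by apply: HCW; exact: wgrad_Lp.
Qed.
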